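(* Let $p\in[1,+\infty)$ and let $\mathcal{F}_W^p$ be a Fock-type space of finite order which contains the set $\mathcal{P}$ of all polynomials as a dense subset. Then any nontrivial backward shift invariant subspace of $\mathcal{F}_W^p$ is of the form $\mathcal{P}_n$ for some integer $n\ge 0$ and, thus, the backward shift $L$ is unicellular on $\mathcal{F}_W^p$.
   Context: A weight is a positive Lebesgue-measurable function $W$ on $\mathbb{C}$; it is always assumed that on every compact subset of $\mathbb{C}$ the weight $W$ is bounded from above and from below by positive constants. $m_2$ is planar Lebesgue measure. For $p\in[1,+\infty)$, the Fock-type space $\mathcal{F}_W^p$ is the Banach space of entire functions $F$ with $\|F\|^p_{\mathcal{F}_W^p}=\int_{\mathbb{C}}|F(z)|^pW(z)\,dm_2(z)<+\infty$. It is said to be of finite order if every $F\in\mathcal{F}_W^p$ is an entire function of finite order. $\mathcal{P}_n$ is the set of all polynomials of degree at most $n$. The backward shift is $Lf(z)=\frac{f(z)-f(0)}{z}$. A closed linear subspace $\mathcal{M}$ of $\mathcal{F}_W^p$ is backward shift invariant if $Lf\in\mathcal{M}$ for every $f\in\mathcal{M}$. A subspace is nontrivial if it is different from $\{0\}$ and from the whole space. An operator is unicellular if its closed invariant subspaces are totally ordered by inclusion. *)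

(* Defs.v *)
From HB Require Import structures.
From mathcomp Require Import all_boot all_order all_algebra.
From mathcomp Require Import complex.
From mathcomp Require Import all_classical all_reals all_analysis.
Set Implicit Arguments.
Unset Strict Implicit.
Unset Printing Implicit Defensive.
Import Order.TTheory GRing.Theory Num.Theory.
Import numFieldNormedType.Exports.
Local Open Scope classical_set_scope.
Local Open Scope ring_scope.
Local Open Scope complex_scope.

(* The regular algebra R[i]^o is what carries the library's topology and
   normed-module structure over the field R[i]. *)
Notation Cplx R := (R[i]^o).

(* The library norm `|z| on R[i] is valued in R[i]; normc is the same modulus
   as an element of R. *)
Notation modulus := ComplexField.Normc.normc.

Definition borel_m2 (R : realType) :=
  (@lebesgue_measure R \x @lebesgue_measure R)%E.
HB.instance Definition _ (R : realType) := Measure.on (@borel_m2 R).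

(* The completion makes all Lebesgue measurable sets of the plane measurable,
   and not only the Borel ones. *)
Definition m2 (R : realType) := @completed_measure_extension _ _ _ (@borel_m2 R).
HB.instance Definition _ (R : realType) := Measure.on (@m2 R).

(* The underlying set is R * R, with the sigma-algebra on which m2 lives. *)
Notation plane R := (caratheodory_type ((@borel_m2 R)^*)%mu).

Definition to_Cplx (R : realType) (w : plane R) : Cplx R := w.1 +i* w.2.

Definition weight (R : realType) (W : Cplx R -> R) : Prop :=
  [/\ forall z, 0 < W z,
      measurable_fun [set: plane R] (W \o @to_Cplx R) &
      forall K : set (Cplx R), compact K ->
        exists a b : R, 0 < a /\ (forall z, K z -> a <= W z <= b)].

Definition entire (R : realType) (F : Cplx R -> Cplx R) : Prop :=
  forall z, derivable F z 1.

Definition finite_order (R : realType) (F : Cplx R -> Cplx R) : Prop :=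
  exists rho r0 : R, forall z : Cplx R,
    r0 <= modulus z -> modulus (F z) <= expR (modulus z `^ rho).

Section fock.
Variables (R : realType) (p : R) (W : Cplx R -> R).
Implicit Types (F f g : Cplx R -> Cplx R) (M N S : set (Cplx R -> Cplx R)).

Definition fock_integral F : \bar R :=
  (\int[@m2 R]_w (modulus (F (to_Cplx w)) `^ p * W (to_Cplx w))%:E)%E.

Definition fock_norm F : \bar R := (fock_integral F `^ p^-1)%E.

Definition fock : set (Cplx R -> Cplx R) :=
  [set F | entire F /\ (fock_integral F < +oo)%E].

Definition fock_dense S : Prop :=
  S `<=` fock /\
  forall f, fock f -> forall e : R, 0 < e ->
    exists2 g, S g & (fock_norm (f \- g)%R < e%:E)%E.

Definition fock_closed M : Prop :=
  forall f, fock f ->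
    (forall e : R, 0 < e -> exists2 g, M g & (fock_norm (f \- g)%R < e%:E)%E) ->
    M f.

Definition closed_subspace M : Prop :=
  [/\ M `<=` fock,
      M (fun=> 0),
      forall (a : Cplx R) f g, M f -> M g -> M (fun z => a * f z + g z) &
      fock_closed M].

Definition invariant_subspace (T : (Cplx R -> Cplx R) -> (Cplx R -> Cplx R)) M
    : Prop :=
  closed_subspace M /\ forall f, M f -> M (T f).

Definition nontrivial_subspace M : Prop :=
  M <> [set (fun=> 0)] /\ M <> fock.

Definition unicellular (T : (Cplx R -> Cplx R) -> (Cplx R -> Cplx R)) : Prop :=
  forall M N, invariant_subspace T M -> invariant_subspace T N ->
    M `<=` N \/ N `<=` M.

End fock.

(* The singularity of (f z - f 0) / z at 0 is removable, with value f' 0. *)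
Definition backward_shift (R : realType) (f : Cplx R -> Cplx R)
    : Cplx R -> Cplx R :=
  fun z => if z == 0 then 'D_1 f 0 else (f z - f 0) / z.

Definition polynomials (R : realType) : set (Cplx R -> Cplx R) :=
  [set f | exists q : {poly R[i]}, f = fun z => q.[z]].

(* size q is the degree plus one (and size 0 = 0). *)
Definition polynomials_le (R : realType) (n : nat) : set (Cplx R -> Cplx R) :=
  [set f | exists2 q : {poly R[i]}, (size q <= n.+1)%N & f = fun z => q.[z]].

(* Main.v *)
Require Import Defs.
From HB Require Import structures.
From mathcomp Require Import all_boot all_order all_algebra.
From mathcomp Require Import complex ring lra.
From mathcomp Require cyclic separable cyclotomic.
From mathcomp Require Import all_classical all_reals all_analysis.
From mathcomp Require Import measurable_realfun.
Set Implicit Arguments.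
Unset Strict Implicit.
Unset Printing Implicit Defensive.
Import Order.TTheory GRing.Theory Num.Theory.
Import numFieldNormedType.Exports.
Local Open Scope classical_set_scope.
Local Open Scope ring_scope.
Local Open Scope complex_scope.

(** Let [R_w f (z) = (f z - f w) / (z - w)], so that [R_0 = L] is the backward shift and
    [R_w = (1 - w L)^-1 L].  As [R_w] is bounded for every [w], summing Neumann series
    along the segment from [0] to [w] shows that an [L]-invariant closed subspace [M] is
    [R_w]-invariant.

    Suppose that [M] contains a function [f] which is not a polynomial.  As [f] has finite
    order, there are [K] and points [w] tending to infinity at which [|f|] exceeds any
    given power of [|w|], with [|f| <= 2 |f w|] on the disc of radius [|w|^-K] around [w].
    At these points [w R_w f / f w] behaves like [w / (w - z)]: the part coming from [f z]
    is negligible outside that disc, and the maximum principle controls [R_w f] inside.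
    Hence [w R_w f / f w] tends to [1], and inductively
    [w^n (w R_w f / f w - sum_(j < n) (z / w)^j)] tends to [z^n].  So [M] contains all
    polynomials and is the whole space.  If [M] only contains polynomials, applying [L]
    to one of them gives all the lower degrees.

    Cauchy's theorem is avoided: by density, every element of the space is a locally
    uniform limit of polynomials, and for polynomials the maximum principle and the
    bounds by area integrals follow from averaging over roots of unity. *)

(** * Lebesgue measure on the plane *)

(** Nothing is known about [W] at infinity, so pointwise information reaches the norm only through
    bounds [|g| <= c (|f| + |h| + |k|)] valid on the whole plane, with [f], [h], [k] in the space.
    This shapes the main estimate: the error in approximating [z^n] is at most [C / |w|] times
    [|f z| + 1 + |z|^(n + K + 2)], a sum of moduli of three elements of the space. The power of
    [|w|] that [|f w|] must exceed is read off from this bound: [n + 1] for a factor [w^(n + 1)],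
    [K] for [1 / |z - w|] outside the small disc, and one more for the decay in [|w|]. As that power
    involves [K], it matters that [K] depends only on the order of [f]. The Neumann argument needs a
    bound on [R_w] that is uniform for [w] in a disc; then finitely many steps of equal length lead
    from [0] to [w]. All norm estimates tolerate constant factors, so crude replacements of Jensen's
    and Minkowski's inequalities suffice. *)

Section plane_measure.
Context {R : realType}.
Local Notation mu := (@lebesgue_measure R).
Local Notation mR := (measurableTypeR R).
Local Open Scope ereal_scope.

Lemma lebesgue_measure_translate (c : R) (A : set mR) : measurable A ->
  pushforward mu ((fun x => (x + c)%R) : mR -> mR) A = mu A.
Proof.
move=> mA; apply/esym.
have mt : measurable_fun setT ((fun x => (x + c)%R) : mR -> mR).
  exact: measurable_funD.
pose phi : {mfun mR >-> mR} :=
  HB.pack ((fun x => (x + c)%R) : mR -> mR)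
    (isMeasurableFun.Build _ _ _ _ _ mt).
apply: (lebesgue_measure_unique (mu := pushforward mu phi)) => //.
move=> _ [[a b]] _ <-.
have E : phi @^-1` `]a, b]%classic = `](a - c)%R, (b - c)%R]%classic.
  by apply/seteqP; split=> x /=; rewrite !in_itv/= ltrBlDr lerBrDr.
rewrite [RHS](_ : _ = mu `](a - c)%R, (b - c)%R]%classic); last first.
  by rewrite -E.
rewrite !lebesgue_measure_itv/= !lte_fin ltrD2r; case: ifP => // _.
by congr (_%:E); ring.
Qed.

Lemma ge0_integral_translate (c : R) (f : mR -> \bar R) :
  measurable_fun setT f -> (forall x, 0 <= f x) ->
  \int[mu]_x f (x + c)%R = \int[mu]_x f x.
Proof.
move=> mf f0.
have mt : measurable_fun setT ((fun x => (x + c)%R) : mR -> mR).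
  exact: measurable_funD.
rewrite -[LHS](ge0_integral_pushforward mt mu (D := setT))//.
apply: eq_measure_integral => A mA _.
exact: lebesgue_measure_translate.
Qed.

(** By Tonelli this reduces to translation invariance on each horizontal line. Translations and
    rotations of the plane are composed of such shears below, so every change of variables comes
    down to translations of the line. *)
Lemma ge0_integral_shear1 (h : mR -> mR) (f : mR * mR -> \bar R) :
  measurable_fun setT h -> measurable_fun setT f -> (forall w, 0 <= f w) ->
  \int[@borel_m2 R]_w f ((w.1 + h w.2)%R, w.2) = \int[@borel_m2 R]_w f w.
Proof.
move=> mh mf f0.
have mg : measurable_fun setT (fun w : mR * mR => f ((w.1 + h w.2)%R, w.2)).
  apply: (measurableT_comp mf); apply: measurable_fun_pair => //=.
  by apply: measurable_funD => //; exact: measurableT_comp.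
rewrite fubini_tonelli2// fubini_tonelli2//.
apply: eq_integral => y _; rewrite /fubini_G/=.
apply: (ge0_integral_translate (h y) (f := fun x => f (x, y))) => //.
exact: measurable_fun_pair1.
Qed.

Lemma ge0_integral_shear2 (h : mR -> mR) (f : mR * mR -> \bar R) :
  measurable_fun setT h -> measurable_fun setT f -> (forall w, 0 <= f w) ->
  \int[@borel_m2 R]_w f (w.1, (w.2 + h w.1)%R) = \int[@borel_m2 R]_w f w.
Proof.
move=> mh mf f0.
have mg : measurable_fun setT (fun w : mR * mR => f (w.1, (w.2 + h w.1)%R)).
  apply: (measurableT_comp mf); apply: measurable_fun_pair => //=.
  by apply: measurable_funD => //; exact: measurableT_comp.
rewrite fubini_tonelli1// fubini_tonelli1//.
apply: eq_integral => x _; rewrite /fubini_F/=.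
apply: (ge0_integral_translate (h x) (f := fun y => f (x, y))) => //.
exact: measurable_fun_pair2.
Qed.

End plane_measure.

(** * Mean values over roots of unity *)

Section modulus_theory.
Context {R : realType}.
Implicit Types (x y z w u : R[i]) (q : {poly R[i]}).

Lemma modulusE z : (modulus z)%:C = `|z|.
Proof. by rewrite normc_def; case: z. Qed.

Lemma modulus_ge0 z : 0 <= modulus z.
Proof. by rewrite -lecR modulusE normr_ge0. Qed.

Lemma modulusX z n : modulus (z ^+ n) = modulus z ^+ n.
Proof. by apply: complexI; rewrite rmorphXn /= !modulusE normrX. Qed.

Lemma modulusB z w : modulus (z - w) = modulus (w - z).
Proof. by apply: complexI; rewrite !modulusE distrC. Qed.

Lemma modulus_nat n : modulus (n%:R : R[i]) = n%:R.
Proof. by apply: complexI; rewrite modulusE normr_nat rmorph_nat. Qed.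

Lemma modulus_real (x : R) : 0 <= x -> modulus x%:C = x.
Proof. by move=> x0; apply: complexI; rewrite modulusE ger0_norm// lecR. Qed.

Lemma modulus_gt0 z : (0 < modulus z) = (z != 0).
Proof. by rewrite -ltcR modulusE normr_gt0. Qed.

Lemma modulus_eq0 z : (modulus z == 0) = (z == 0).
Proof. by rewrite -(inj_eq (@complexI R)) modulusE normr_eq0. Qed.

Lemma ler_modulusD z w : modulus (z + w) <= modulus z + modulus w.
Proof. exact: le_normcD. Qed.

Lemma ler_modulus_dist z w : modulus z - modulus w <= modulus (z - w).
Proof. by rewrite lerBlDr (le_trans _ (ler_modulusD _ _))// subrK. Qed.

Lemma ler_modulus_sum (I : Type) (r : seq I) (P : pred I) (F : I -> R[i]) :
  modulus (\sum_(i <- r | P i) F i) <= \sum_(i <- r | P i) modulus (F i).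
Proof.
elim/big_ind2 : _ => [|x a y b xa yb|//].
  by rewrite ComplexField.Normc.normc0.
by rewrite (le_trans (ler_modulusD _ _))// lerD.
Qed.

(** [X^n - 1] splits and has no multiple root in characteristic [0], so it has [n] distinct roots; a
    finite group of units of a field is cyclic. *)
Lemma prim_root_complex n : (0 < n)%N -> exists z : R[i], n.-primitive_root z.
Proof.
move=> n0; pose p : {poly R[i]} := 'X^n - 1.
have [r Dp] := closed_field_poly_normal p.
rewrite (monicP _) ?monicXnsubC // scale1r in Dp.
have rn1 : all n.-unity_root r.
  by apply/allP=> z; rewrite -root_prod_XsubC -Dp.
have sz_r : (n < (size r).+1)%N.
  by rewrite -(size_prod_XsubC r id) -Dp size_XnsubC.
have [|z] := hasP (cyclic.has_prim_root n0 rn1 _ sz_r); last by exists z.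
by rewrite -separable.separable_prod_XsubC -Dp cyclotomic.separable_Xn_sub_1 // pnatr_eq0 -lt0n.
Qed.

Lemma prim_root_modulus n z : n.-primitive_root z -> modulus z = 1.
Proof.
move=> zn; have n0 := prim_order_gt0 zn.
apply/eqP; rewrite -(@pexpr_eq1 _ _ n)// ?modulus_ge0// -modulusX prim_expr_order//.
by rewrite ComplexField.Normc.normc1.
Qed.

Lemma sum_prim_root n z k : n.-primitive_root z -> (0 < k < n)%N ->
  \sum_(j < n) (z ^+ j) ^+ k = 0.
Proof.
move=> zn /andP[k0 kn].
have zk1 : z ^+ k != 1.
  by rewrite -(prim_order_dvd zn) gtnNdvd.
apply: (mulfI (x := z ^+ k - 1)); first by rewrite subr_eq0.
under eq_bigr => j _ do rewrite -exprM mulnC exprM.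
by rewrite mulr0 -subrX1 exprAC (prim_expr_order zn) expr1n subrr.
Qed.

(** The discrete mean value property on the circle around [w] through [w + u]. It is exact:
    expanding [q] at [w] leaves powers below [n] only, and the powers [1] to [n - 1] sum to [0] over
    the roots of unity. *)
Lemma horner_mean q n z w u : n.-primitive_root z -> (size q <= n)%N ->
  \sum_(j < n) q.[w + u * z ^+ j] = n%:R * q.[w].
Proof.
move=> zn qn.
have n0 := prim_order_gt0 zn.
set r := q \Po ('X + w%:P).
have rE x : q.[w + x] = r.[x] by rewrite horner_comp !hornerE addrC.
have rn : (size r <= n)%N.
  by rewrite size_comp_poly2// size_XaddC.
under eq_bigr => j _ do rewrite rE (horner_coef_wide _ rn).
rewrite exchange_big /= -[w in RHS]addr0 rE horner_coef0.
under eq_bigr => i _.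
  under eq_bigr => j _ do rewrite exprMn mulrA.
  rewrite -mulr_sumr; over.
rewrite (bigD1 (Ordinal n0))//= [X in _ + X]big1.
  rewrite addr0; under eq_bigr do rewrite expr0.
  by rewrite sumr_const card_ord expr0 mulr1 mulrC.
move=> i i0.
by rewrite (sum_prim_root zn) ?mulr0// ltn_ord lt0n andbT.
Qed.

Lemma modulus_horner_mean q n z w u : n.-primitive_root z -> (size q <= n)%N ->
  n%:R * modulus q.[w] <= \sum_(j < n) modulus q.[w + u * z ^+ j].
Proof.
move=> zn qn; rewrite -modulus_nat -ComplexField.Normc.normcM.
by rewrite -(horner_mean w u zn qn) ler_modulus_sum.
Qed.

End modulus_theory.

(** * Integrals over discs in the plane *)

Definition complex_of_pair {R : realType} (w : R * R) : R[i] := w.1 +i* w.2.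

Section area_mean.
Context {R : realType}.
Local Notation mR := (measurableTypeR R).
Local Notation cx := (@complex_of_pair R).
Implicit Types (z u v : R[i]) (q : {poly R[i]}) (f : R[i] -> \bar R).

Lemma powR_predM (a p : R) : 0 <= a -> 1 <= p -> a `^ (p - 1) * a = a `^ p.
Proof.
rewrite le_eqVlt => /predU1P[<- p1|a0 p1].
  by rewrite mulr0 powR0// gt_eqF// (lt_le_trans ltr01).
by rewrite -[X in _ * X]powRr1 ?ltW// -powRD ?subrK// (gt_eqF a0) implybT.
Qed.

(** A substitute for Jensen's inequality, at the price of a factor [2]. One sums
    [(t / 2)^(p - 1) (s j - t / 2) <= (s j)^p], which is trivial when [s j <= t / 2]; the
    differences [s j - t / 2] add up to at least [n t / 2]. *)
Lemma powR_half_mean n (p t : R) (s : 'I_n -> R) : 1 <= p -> 0 <= t ->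
  (forall j, 0 <= s j) -> n%:R * t <= \sum_j s j ->
  n%:R * (t / 2) `^ p <= \sum_j s j `^ p.
Proof.
move=> p1 t0 s0 ts; have h0 : 0 <= t / 2 by rewrite divr_ge0.
have key j : (t / 2) `^ (p - 1) * (s j - t / 2) <= s j `^ p.
  have [sh|/ltW hs] := leP (s j) (t / 2).
    rewrite (le_trans _ (powR_ge0 _ _))// mulr_ge0_le0 ?powR_ge0//.
    by rewrite subr_le0.
  rewrite -(powR_predM (s0 j) p1) ler_pM ?powR_ge0 ?subr_ge0 ?gerBl//.
  by rewrite ge0_ler_powR ?subr_ge0 ?nnegrE.
apply: le_trans (ler_sum _ (fun j _ => key j)).
rewrite -mulr_sumr sumrB sumr_const card_ord -(powR_predM h0 p1).
rewrite mulrCA ler_wpM2l ?powR_ge0// -[(t / 2) *+ n]mulr_natl lerBrDr.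
by rewrite (le_trans _ ts)// -mulrDr -splitr.
Qed.

Section measurability.
Context d (T : measurableType d) (X Y : T -> mR).
Context (mX : measurable_fun setT X) (mY : measurable_fun setT Y).

Lemma measurable_horner_ReIm q :
  measurable_fun setT (fun t => complex.Re q.[X t +i* Y t] : R) /\
  measurable_fun setT (fun t => complex.Im q.[X t +i* Y t] : R).
Proof.
elim/poly_ind : q => [|q c [mr mi]].
  by split; under eq_fun do rewrite horner0 /=; exact: measurable_cst.
split; under eq_fun do rewrite hornerMXaddC.
  under eq_fun => t.
    rewrite (_ : complex.Re _ = complex.Re q.[X t +i* Y t] * X t - complex.Im q.[X t +i* Y t] * Y t
      + complex.Re c); last by case: (q.[_]); case: c.
    over.
  apply: measurable_funD; last exact: measurable_cst.
  by apply: measurable_funB; exact: measurable_funM.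
under eq_fun => t.
  rewrite (_ : complex.Im _ = complex.Re q.[X t +i* Y t] * Y t + complex.Im q.[X t +i* Y t] * X t
    + complex.Im c); last by case: (q.[_]); case: c.
  over.
apply: measurable_funD; last exact: measurable_cst.
by apply: measurable_funD; exact: measurable_funM.
Qed.

Lemma measurable_modulus_horner q :
  measurable_fun setT (fun t => modulus q.[X t +i* Y t] : R).
Proof.
have [mr mi] := measurable_horner_ReIm q.
under eq_fun => t.
  rewrite (_ : modulus _ = Num.sqrt (complex.Re q.[X t +i* Y t] ^+ 2 +
    complex.Im q.[X t +i* Y t] ^+ 2)); last by case: (q.[_]).
  over.
apply: (@measurableT_comp _ _ _ _ _ _ (@Num.sqrt R)).
  by apply: continuous_measurable_fun; exact: sqrt_continuous.
by apply: measurable_funD; exact: measurable_funX.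
Qed.

End measurability.

Lemma ge0_integral_translateC v f :
  measurable_fun setT (fun w : mR * mR => f (cx w)) ->
  (forall z, 0 <= f z)%E ->
  (\int[@borel_m2 R]_w f (cx w + v)%R =
   \int[@borel_m2 R]_w f (cx w))%E.
Proof.
case: v => a b mf f0.
transitivity (\int[@borel_m2 R]_w f (cx (w.1, (w.2 + b)%R)))%E; last first.
  apply: (@ge0_integral_shear2 _ (cst b) (fun w => f (cx w))) => //.
apply: (@ge0_integral_shear1 _ (cst a) (fun w => f (cx (w.1, (w.2 + b)%R)))) => //.
apply: (measurableT_comp mf (g := fun w : mR * mR => (w.1, w.2 + b))).
apply: measurable_fun_pair => //.
exact: measurable_funD.
Qed.

(** For [u = cos a + i sin a] the two horizontal shears have coefficient
    [(cos a - 1) / sin a = - tan (a / 2)] and the vertical one has coefficient [sin a], whence the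
    hypothesis on the imaginary part. *)
Lemma ge0_integral_rotation u f : modulus u = 1 -> complex.Im u != 0 ->
  measurable_fun setT (fun w : mR * mR => f (cx w)) ->
  (forall z, 0 <= f z)%E ->
  (\int[@borel_m2 R]_w f (u * cx w)%R =
   \int[@borel_m2 R]_w f (cx w))%E.
Proof.
case: u => c s /= cs s0 mf f0.
have {}cs : c ^+ 2 + s ^+ 2 = 1.
  have /(congr1 (fun x => x ^+ 2)) := cs; rewrite expr1n sqr_sqrtr//.
  by rewrite addr_ge0 ?sqr_ge0.
(* A rotation is a product of three shears. *)
pose al := (c - 1) / s.
pose S1 (w : mR * mR) : mR * mR := (w.1 + al * w.2, w.2).
pose S2 (w : mR * mR) : mR * mR := (w.1, w.2 + s * w.1).
pose g (w : mR * mR) := f (cx w).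
have mS1 : measurable_fun setT S1.
  apply: measurable_fun_pair => //; apply: measurable_funD => //.
  exact: measurable_funM.
have mS2 : measurable_fun setT S2.
  apply: measurable_fun_pair => //; apply: measurable_funD => //.
  exact: measurable_funM.
have E w : f ((c +i* s) * (cx w)) = g (S1 (S2 (S1 w))).
  rewrite /g /S1 /S2 /cx/=; simpc; congr (f (_ +i* _)).
  - rewrite /al; apply: (mulfI s0).
    have -> : s * (c * w.1 - s * w.2) = s * c * w.1 - (1 - c ^+ 2) * w.2.
      by rewrite -cs; ring.
    by field.
  - by rewrite /al; field.
under eq_integral do rewrite E.
transitivity (\int[@borel_m2 R]_w g (S1 (S2 w)))%E.
  apply: (@ge0_integral_shear1 _ (fun y => al * y) (fun w => g (S1 (S2 w)))).
  - exact: measurable_funM.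
  - by apply: (measurableT_comp mf); exact: measurableT_comp.
  - by move=> w; exact: f0.
transitivity (\int[@borel_m2 R]_w g (S1 w))%E.
  apply: (@ge0_integral_shear2 _ (fun x => s * x) (fun w => g (S1 w))).
  - exact: measurable_funM.
  - exact: (measurableT_comp mf).
  - by move=> w; exact: f0.
apply: (@ge0_integral_shear1 _ (fun y => al * y) g) => //.
- exact: measurable_funM.
- by move=> w; exact: f0.
Qed.

(** The real case leaves [u = 1] and [u = -1]; the latter is two successive rotations by [i]. *)
Lemma ge0_integral_rotationC u f : modulus u = 1 ->
  measurable_fun setT (fun w : mR * mR => f (cx w)) ->
  (forall z, 0 <= f z)%E ->
  (\int[@borel_m2 R]_w f (u * cx w)%R = \int[@borel_m2 R]_w f (cx w))%E.
Proof.
move=> u1 mf f0.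
have [ui|ui] := eqVneq (complex.Im u) 0; last exact: ge0_integral_rotation.
have {}ui : u = (complex.Re u)%:C by case: u ui {u1} => a b /= ->.
have : complex.Re u ^+ 2 = 1.
  have /(congr1 (fun x => x ^+ 2)) := u1; rewrite ui/= expr1n sqr_sqrtr.
    by rewrite expr0n addr0.
  by rewrite addr_ge0 ?sqr_ge0.
move/eqP; rewrite sqrf_eq1 => /orP[]/eqP ur.
  by rewrite ui ur; under eq_integral do rewrite mul1r.
have i1 : modulus ('i%C : R[i]) = 1 by rewrite /= expr0n add0r expr1n sqrtr1.
have uE : u = 'i%C * 'i%C.
  by rewrite ui ur rmorphN1 -expr2 sqr_i.
transitivity (\int[@borel_m2 R]_w f ('i%C * ('i%C * cx w))%R)%E.
  by apply: eq_integral => w _; rewrite uE mulrA.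
rewrite (ge0_integral_rotation (f := fun z => f ('i%C * z)))//.
- by rewrite ge0_integral_rotation//= oner_eq0.
- by rewrite /= oner_eq0.
- have -> : (fun w : mR * mR => f ('i%C * cx w)) =
      (fun w : mR * mR => f (cx w)) \o (fun w => (- w.2, w.1)).
    by apply/funext => w /=; rewrite /complex_of_pair; congr f; simpc.
  apply: measurableT_comp => //; apply: measurable_fun_pair => //.
  exact: measurable_funN.
Qed.

Definition unit_disc_indicator z : R := (modulus z <= 1)%R%:R.
Local Notation chi := unit_disc_indicator.

Lemma unit_disc_indicator_ge0 z : 0 <= chi z. Proof. exact: ler0n. Qed.

Lemma measurable_modulus_sub d (T : measurableType d) (X Y : T -> mR) v :
  measurable_fun setT X -> measurable_fun setT Y ->
  measurable_fun setT (fun t => modulus (X t +i* Y t - v) : R).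
Proof.
move=> mX mY; have := measurable_modulus_horner mX mY ('X - v%:P).
by under eq_fun do rewrite hornerXsubC.
Qed.

Lemma measurable_unit_disc_indicator d (T : measurableType d) (X Y : T -> mR) v :
  measurable_fun setT X -> measurable_fun setT Y ->
  measurable_fun setT (fun t => chi (X t +i* Y t - v) : R).
Proof.
move=> mX mY; rewrite /chi.
have := measurable_fun_ler (measurable_modulus_sub v mX mY) (measurable_cst (1 : R)).
by move=> mb; apply: (measurableT_comp (f := fun b : bool => b%:R : R)).
Qed.

(** What matters of this number is that it is positive and finite, by comparison with a square
    inside and a square around the disc. *)
Definition disc_area : \bar R := (\int[@borel_m2 R]_w (chi (cx w))%:E)%E.

Lemma measurable_unit_disc_indicator0 : measurable_fun setT (fun w : mR * mR => chi (cx w) : R).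
Proof.
have := @measurable_unit_disc_indicator _ (mR * mR)%type fst snd 0 measurable_fst measurable_snd.
by under eq_fun do rewrite subr0.
Qed.

Lemma borel_m2_square (a b c e : R) : a <= b -> c <= e ->
  @borel_m2 R (`]a, b]%classic `*` `]c, e]%classic) = ((b - a) * (e - c))%:E.
Proof.
move=> ab ce.
transitivity (lebesgue_measure `]a, b] * lebesgue_measure `]c, e])%E.
  exact: product_measure1E.
rewrite !lebesgue_measure_itv/= !lte_fin EFinM.
by congr (_ * _)%E; case: ltgtP ab ce => // -> _; 
   rewrite ?subrr//; case: ltgtP => // ->; rewrite subrr.
Qed.

Lemma disc_area_gt0 : (0 < disc_area)%E.
Proof.
pose Q : set (mR * mR) := `]0, 2^-1]%classic `*` `]0, 2^-1]%classic.
have mQ : measurable Q by exact: measurableX.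
apply: (@lt_le_trans _ _ (@borel_m2 R Q)).
  by rewrite borel_m2_square ?invr_ge0// lte_fin subr0 mulr_gt0// invr_gt0.
rewrite -[Q]setIT -integral_indic//; apply: ge0_le_integral => //.
- by apply/measurable_EFinP; exact: measurable_indic.
- by apply/measurable_EFinP; exact: measurable_unit_disc_indicator0.
move=> [x y] _; rewrite lee_fin indicE /chi ler_nat.
have [/set_mem[/=]|//] := boolP (_ \in _).
rewrite !in_itv/= => /andP[x0 x1] /andP[y0 y1].
suff -> : Num.sqrt (x ^+ 2 + y ^+ 2) <= 1 by [].
by rewrite -sqrtr1 ler_wsqrtr//; nra.
Qed.

Lemma disc_area_lty : (disc_area < +oo)%E.
Proof.
pose Q : set (mR * mR) := `](-2), 2]%classic `*` `](-2), 2]%classic.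
have mQ : measurable Q by exact: measurableX.
apply: (@le_lt_trans _ _ (@borel_m2 R Q)); last first.
  by rewrite borel_m2_square ?ltry// ?(le_trans _ (ler0n _ _))// oppr_le0.
rewrite -[Q]setIT -integral_indic//; apply: ge0_le_integral => //.
- by move=> w _; rewrite lee_fin unit_disc_indicator_ge0.
- by apply/measurable_EFinP; exact: measurable_unit_disc_indicator0.
- by apply/measurable_EFinP; exact: measurable_indic.
move=> -[x y] _; rewrite lee_fin indicE /chi ler_nat.
have [|//] := boolP (_ <= _) => /= xy1.
rewrite -[X in _ <= X]sqrtr1 ler_sqrt// in xy1.
have := sqr_ge0 x; have := sqr_ge0 y => y0 x0.
by rewrite mem_set//; split => /=; rewrite in_itv/=; apply/andP; split; nra.
Qed.

(* Average [|q (v + z^j u)|^p] over the roots of unity [z^j], then integrate over the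
   disc of the [u], which is invariant under rotations. *)
Lemma area_mean (p : R) q v : 1 <= p ->
  (((modulus q.[v] / 2) `^ p)%:E * disc_area <=
   \int[@borel_m2 R]_w (modulus q.[cx w] `^ p * chi (cx w - v))%:E)%E.
Proof.
move=> p1.
have [n n0 qn] : exists2 n, (0 < n)%N & (size q <= n)%N by exists (size q).+1.
have [z zn] := @prim_root_complex R _ n0.
have m1 r : measurable_fun setT (fun w : mR * mR => modulus r.[cx w] `^ p : R).
  apply: (measurableT_comp (measurable_powR _)).
  exact: (@measurable_modulus_horner _ (mR * mR)%type fst snd).
pose g y := (modulus q.[v + y] `^ p * chi y)%:E.
have g0 y : (0 <= g y)%E by rewrite lee_fin mulr_ge0 ?powR_ge0 ?unit_disc_indicator_ge0.
have mg : measurable_fun setT (fun w : mR * mR => g (cx w)).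
  apply/measurable_EFinP; apply: measurable_funM; last exact: measurable_unit_disc_indicator0.
  have := m1 (q \Po ('X + v%:P)).
  by under eq_fun do rewrite horner_comp !hornerE addrC.
have mgz j : measurable_fun setT (fun w : mR * mR => g (z ^+ j * cx w)).
  have zj1 : modulus (z ^+ j) = 1.
    by rewrite modulusX (prim_root_modulus zn) expr1n.
  apply/measurable_EFinP; apply: measurable_funM.
    have := m1 (q \Po ((z ^+ j) *: 'X + v%:P)).
    by under eq_fun do rewrite horner_comp !hornerE addrC.
  rewrite /chi; under eq_fun do rewrite ComplexField.Normc.normcM zj1 mul1r.
  exact: measurable_unit_disc_indicator0.
rewrite [leRHS](_ : _ = \int[@borel_m2 R]_w g (cx w))%E; last first.
  rewrite -(@ge0_integral_translateC (- v)).
  - by apply: eq_integral => w _; rewrite /g [v + _]addrC subrK.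
  - exact: mg.
  - exact: g0.
have n0R : 0 < n%:R :> R by rewrite ltr0n.
rewrite -(lee_pmul2l (x := n%:R%:E)) ?lte_fin//.
have -> : (n%:R%:E * \int[@borel_m2 R]_w g (cx w) =
    \int[@borel_m2 R]_w (\sum_(j < n) g (z ^+ j * cx w)%R))%E.
  rewrite ge0_integral_sum//.
  under eq_bigr => j _.
    rewrite ge0_integral_rotationC//; last first.
      by rewrite modulusX (prim_root_modulus zn) expr1n.
    over.
  by rewrite sumr_const card_ord mule_natl.
rewrite muleA -EFinM -ge0_integralZl//; last 3 first.
- by apply/measurable_EFinP; exact: measurable_unit_disc_indicator0.
- by move=> w _; rewrite lee_fin unit_disc_indicator_ge0.
- by rewrite lee_fin mulr_ge0// powR_ge0.
apply: ge0_le_integral => //.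
- move=> w _; rewrite -EFinM lee_fin mulr_ge0 ?unit_disc_indicator_ge0//.
  by rewrite mulr_ge0// powR_ge0.
- apply/measurable_EFinP; apply: measurable_funM => //.
  exact: measurable_unit_disc_indicator0.
- exact: emeasurable_sum.
move=> w _; rewrite /g sumEFin -EFinM lee_fin.
under eq_bigr => j _.
  rewrite (_ : chi _ = chi (cx w)); last first.
    by rewrite /chi ComplexField.Normc.normcM modulusX (prim_root_modulus zn)
      expr1n mul1r.
  over.
rewrite -mulr_suml ler_wpM2r ?unit_disc_indicator_ge0//.
apply: powR_half_mean => // [|j|]; rewrite ?modulus_ge0//.
under eq_bigr do rewrite mulrC.
exact: modulus_horner_mean.
Qed.

End area_mean.

(** * Topology of the complex plane *)

Section complex_topology.
Context {R : realType}.
Local Notation cx := (@complex_of_pair R).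
Implicit Types (z w y : R[i]) (f g : Cplx R -> Cplx R).

Lemma nbhs_modulusP (z : Cplx R) (A : set (Cplx R)) :
  nbhs z A <-> exists2 e : R, 0 < e & forall y, modulus (y - z) < e -> A y.
Proof.
split => [/nbhs_ballP[e/= e0 eA]|[e e0 eA]].
  have eE : e = (complex.Re e)%:C by rewrite RRe_real// gtr0_real.
  exists (complex.Re e) => [|y yz]; first by rewrite -ltcR -eE.
  by apply: eA; rewrite /ball/= -modulusE eE ltcR modulusB.
apply/nbhs_ballP; exists e%:C; first by rewrite /= ltcR.
by move=> y; rewrite /ball/= -modulusE ltcR modulusB => /eA.
Qed.

Lemma modulusB_continuous (v : R[i]) :
  continuous (fun z : Cplx R => modulus (z - v) : R).
Proof.
move=> z A /nbhs_ballP[e /= e0 eA]; apply/nbhs_modulusP; exists e => // y yz.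
apply: eA; apply: le_lt_trans yz; rewrite distrC ler_norml.
have h1 : modulus (y - v) - modulus (z - v) <= modulus (y - z).
  by have := ler_modulus_dist (y - v) (z - v); rewrite opprB addrA subrK.
have h2 : modulus (z - v) - modulus (y - v) <= modulus (y - z).
  have := ler_modulus_dist (z - v) (y - v).
  by rewrite opprB addrA subrK [modulus (z - y)]modulusB.
by apply/andP; split; [rewrite lerNl opprB; exact: h2|exact: h1].
Qed.

Lemma complex_of_pair_continuous : continuous (cx : R * R -> Cplx R).
Proof.
move=> [a b] A /nbhs_modulusP[e e0 eA].
have e20 : 0 < e / 2 by rewrite divr_gt0.
exists (ball a (e / 2), ball b (e / 2)); first by split; exact: nbhsx_ballx.
move=> [c d] [/= ac bd]; apply: eA; apply: le_lt_trans (_ : `|c - a| + `|d - b| < e).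
  have -> : cx (c, d) - cx (a, b) = (c - a)%:C + 'i%C * (d - b)%:C.
    by rewrite /complex_of_pair; simpc.
  rewrite (le_trans (ler_modulusD _ _))// lerD//.
    by rewrite /= expr0n addr0 sqrtr_sqr.
  rewrite ComplexField.Normc.normcM /= !expr0n add0r expr1n sqrtr1 mul1r addr0.
  by rewrite sqrtr_sqr.
by rewrite [ltRHS]splitr ltrD// distrC.
Qed.

Lemma Re_Im_le_modulus (a b : R) :
  `|a| <= modulus (a +i* b) /\ `|b| <= modulus (a +i* b).
Proof.
by rewrite -!sqrtr_sqr /= !ler_wsqrtr ?lerDl ?lerDr ?sqr_ge0.
Qed.

Lemma compact_disc (v : Cplx R) (r : R) :
  compact [set z : Cplx R | modulus (z - v) <= r].
Proof.
case: v => a b.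
pose Q := (cx : R * R -> Cplx R) @` (`[a - r, a + r] `*` `[b - r, b + r]).
have cQ : compact Q.
  apply: continuous_compact; last by apply: compact_setX; exact: segment_compact.
  exact/continuous_subspaceT/complex_of_pair_continuous.
apply: (subclosed_compact _ cQ).
  have /continuous_closedP := @modulusB_continuous (a +i* b).
  by move=> /(_ _ (@closed_le R r)).
move=> [c d] /= zr; exists (c, d) => //; split => /=; rewrite in_itv/=.
  have : `|c - a| <= r by rewrite (le_trans _ zr)//; case: (Re_Im_le_modulus (c - a) (d - b)).
  by rewrite ler_distl.
have : `|d - b| <= r by rewrite (le_trans _ zr)//; case: (Re_Im_le_modulus (c - a) (d - b)).
by rewrite ler_distl.
Qed.

End complex_topology.

(** * The completed Lebesgue measure *)

Section completed_plane.
Context {R : realType}.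
Local Notation mR := (measurableTypeR R).
Local Open Scope ereal_scope.

(** It holds for arbitrary functions because the integral of a nonnegative function is a supremum
    over the simple functions below it. *)
Lemma ge0_le_integralT d (T : measurableType d)
    (mu : {measure set T -> \bar R}) (f g : T -> \bar R) :
  (forall x, 0 <= f x) -> (forall x, f x <= g x) ->
  \int[mu]_x f x <= \int[mu]_x g x.
Proof.
move=> f0 fg; have g0 x : 0 <= g x by exact: le_trans (f0 x) (fg x).
rewrite !ge0_integralTE//; apply: le_ereal_sup => _ [h hf <-].
by exists h => // x; exact: le_trans (hf x) (fg x).
Qed.

Lemma plane_measurable (A : set (mR * mR)) :
  measurable A -> measurable (A : set (plane R)).
Proof. by move=> mA; apply: sub_caratheodory; exact: sub_sigma_algebra. Qed.

Lemma m2_borelE (A : set (mR * mR)) : measurable A -> @m2 R A = @borel_m2 R A.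
Proof. by move=> mA; rewrite /m2 /completed_measure_extension measurable_mu_extE. Qed.

(** The identity is measurable from the completed plane to the Borel plane, and it pushes [m2]
    forward to [borel_m2]. *)
Lemma integral_m2_borelE (f : mR * mR -> \bar R) : measurable_fun setT f ->
  (forall w, 0 <= f w) ->
  \int[@m2 R]_w f w = \int[@borel_m2 R]_w f w.
Proof.
move=> mf f0.
have mid : measurable_fun setT (id : plane R -> mR * mR).
  by move=> _ A mA; rewrite setTI; exact: plane_measurable.
rewrite -[LHS](ge0_integral_pushforward mid (@m2 R) (D := setT))//.
apply: eq_measure_integral => A mA _; exact: m2_borelE.
Qed.

End completed_plane.

(** * Locally uniform limits of polynomials *)

Section divided_difference.
Context {R : realType}.
Local Open Scope complex_scope.
Implicit Types (z w y : R[i]) (f g : Cplx R -> Cplx R) (q : {poly R[i]}).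

Lemma derivative_modulusP f w (d : Cplx R) :
  ((fun h : Cplx R => (h : R[i])^-1 *: ((f \o shift (w : Cplx R)) ((h : R[i]) *: (1 : Cplx R)) - f w))
     @ (0 : Cplx R)^' --> d) <->
  forall e : R, 0 < e -> exists2 del : R, 0 < del &
    forall z, z != w -> modulus (z - w) < del ->
      modulus ((f z - f w) / (z - w) - d) < e.
Proof.
have E h : h^-1 *: ((f \o shift (w : Cplx R)) (h *: (1 : Cplx R)) - f w) =
    (f (w + h) - f w) / (w + h - w).
  by rewrite /= [w + h]addrC addrK /GRing.scale/= mulr1 mulrC.
split=> [fd e e0|fd].
  have : nbhs d [set y | modulus (y - d) < e] by apply/nbhs_modulusP; exists e.
  move=> /fd; rewrite /dnbhs /within /= => /nbhs_ballP[del/= del0 dP].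
  have dE : del = (complex.Re del)%:C by rewrite RRe_real// gtr0_real.
  exists (complex.Re del) => [|z zw zd]; first by rewrite -ltcR -dE.
  have := dP (z - w); rewrite E [w + _]addrC subrK; apply.
    by rewrite /ball/= sub0r normrN -modulusE dE ltcR.
  by rewrite subr_eq0.
move=> A /nbhs_modulusP[e e0 eA]; have [del del0 dP] := fd _ e0.
rewrite /= /dnbhs /within /=; apply/nbhs_ballP; exists del%:C; first by rewrite /= ltcR.
move=> h; rewrite /ball/= sub0r normrN -modulusE ltcR => hd h0.
rewrite E; apply: eA; apply: dP; last by rewrite [w + h]addrC addrK.
by rewrite -subr_eq0 [w + h]addrC addrK.
Qed.

Lemma derivable_modulusP f w : derivable f (w : Cplx R) 1 ->
  forall e : R, 0 < e -> exists2 del : R, 0 < del &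
    forall z, z != w -> modulus (z - w) < del ->
      modulus ((f z - f w) / (z - w) - 'D_1 f (w : Cplx R)) < e.
Proof. by move=> df; apply/derivative_modulusP. Qed.

Lemma derivative_modulusE f w (d : Cplx R) :
  (forall e : R, 0 < e -> exists2 del : R, 0 < del &
    forall z, z != w -> modulus (z - w) < del ->
      modulus ((f z - f w) / (z - w) - d) < e) ->
  derivable f (w : Cplx R) 1 /\ 'D_1 f (w : Cplx R) = d.
Proof.
move=> /derivative_modulusP fd; split; first by apply/cvg_ex; exists d.
exact: cvg_lim fd.
Qed.

Lemma poly_disc_bounded q v (r : R) : exists2 B : R, 0 <= B &
  forall z, modulus (z - v) <= r -> modulus q.[z] <= B.
Proof.
have [r0|r0] := leP 0 r; last first.
  by exists 0 => // z /le_lt_trans /(_ r0); rewrite ltNge modulus_ge0.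
elim/poly_ind : q => [|q c [B B0 qB]].
  by exists 0 => // z _; rewrite horner0 ComplexField.Normc.normc0.
exists (B * (r + modulus v) + modulus c).
  by rewrite addr_ge0 ?mulr_ge0 ?addr_ge0 ?modulus_ge0.
move=> z zr; rewrite hornerMXaddC (le_trans (ler_modulusD _ _))// lerD2r.
rewrite ComplexField.Normc.normcM ler_pM ?modulus_ge0 ?qB//.
by rewrite -[z](subrK v) (le_trans (ler_modulusD _ _))// lerD2r.
Qed.

Lemma poly_divided_difference q w :
  exists p : {poly R[i]}, forall z, q.[z] - q.[w] = p.[z] * (z - w).
Proof.
have /factor_theorem[p pE] : root (q - q.[w]%:P) w.
  by rewrite rootE !hornerE subrr.
exists p => z; have /(congr1 (fun r => r.[z])) := pE.
by rewrite hornerD hornerN hornerC hornerM hornerXsubC.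
Qed.

Lemma horner_modulusP q w (e : R) : 0 < e -> exists2 del : R, 0 < del &
    forall z, modulus (z - w) < del -> modulus (q.[z] - q.[w]) < e.
Proof.
move=> e0; have [p pE] := poly_divided_difference q w.
have [B B0 pB] := poly_disc_bounded p w 1.
have B1 : 0 < B + 1 by rewrite ltr_wpDl.
exists (Order.min 1 (e / (B + 1))) => [|z]; first by rewrite lt_min ltr01 divr_gt0.
rewrite lt_min => /andP[/ltW z1 ze]; rewrite pE ComplexField.Normc.normcM.
rewrite (@le_lt_trans _ _ ((B + 1) * modulus (z - w)))//.
  by rewrite ler_wpM2r ?modulus_ge0// (le_trans (pB _ z1))// lerDl.
by rewrite mulrC -ltr_pdivlMr.
Qed.

Lemma horner_continuousC q : continuous (horner q : Cplx R -> Cplx R).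
Proof.
move=> w A /nbhs_modulusP[e /(horner_modulusP q w)[d d0 dP] eA].
by apply/nbhs_modulusP; exists d => // z /dP; exact: eA.
Qed.

Lemma poly_max_disc q v (r : R) : 0 <= r -> exists2 c, modulus (c - v) <= r &
  forall z, modulus (z - v) <= r -> modulus q.[z] <= modulus q.[c].
Proof.
move=> r0.
have [||c /set_mem cD cP] := @compact_EVT_max (Cplx R) R
  (fun z => modulus q.[z]) [set z | modulus (z - v) <= r] _ (@compact_disc R v r).
- by exists v => /=; rewrite subrr ComplexField.Normc.normc0.
- apply: continuous_subspaceT => z.
  rewrite (_ : (fun y => modulus q.[y]) =
      (fun y : Cplx R => modulus (y - 0)) \o (horner q : Cplx R -> Cplx R)).
    apply: continuous_comp; first exact: horner_continuousC.
    exact: modulusB_continuous.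
  by apply/funext => y /=; rewrite subr0.
by exists c => // z zr; apply: cP; exact/mem_set.
Qed.

(** Let [|q|] be maximal on the disc at an interior point [c]. The points [c + u t^j] all stay in
    the disc and [c + u] is on its boundary, so that the mean value bound reads
    [n |q c| <= |q (c + u)| + (n - 1) |q c|]. *)
Lemma poly_max_principle q v (r B : R) : 0 <= r ->
  (forall z, modulus (z - v) = r -> modulus q.[z] <= B) ->
  forall z, modulus (z - v) <= r -> modulus q.[z] <= B.
Proof.
move=> r0 qB z zr; have [c cr cP] := poly_max_disc q v r0.
apply: le_trans (cP _ zr) _.
have [cvr|cvr] := eqVneq (modulus (c - v)) r; first exact: qB.
set d := r - modulus (c - v).
have d0 : 0 <= d by rewrite subr_ge0.
(* [u] leads radially outwards from [c] to the circle, in the direction of [c - v], or along the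
   real axis when [c] is the centre. *)
have [u ud cur] : exists2 u, modulus u = d & modulus (c + u - v) = r.
  have [cv|cv] := eqVneq c v.
    exists d%:C; rewrite ?modulus_real// cv [v + _]addrC addrK modulus_real//.
    by rewrite /d cv subrr ComplexField.Normc.normc0 subr0.
  have cv0 : modulus (c - v) != 0 by rewrite modulus_eq0 subr_eq0.
  pose s := d / modulus (c - v).
  have s0 : 0 <= s by rewrite divr_ge0 ?modulus_ge0.
  exists (s%:C * (c - v)).
    by rewrite ComplexField.Normc.normcM modulus_real// divfK.
  rewrite (_ : _ - v = (s + 1)%:C * (c - v)); last first.
    by rewrite rmorphD /=; ring.
  rewrite ComplexField.Normc.normcM modulus_real ?addr_ge0//.
  by rewrite mulrDl divfK// mul1r subrK.
have [n n0 qn] : exists2 n, (0 < n)%N & (size q <= n)%N by exists (size q).+1.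
have [t tn] := @prim_root_complex R _ n0.
have := modulus_horner_mean c u tn qn.
rewrite (bigD1 (Ordinal n0))//= expr0 mulr1.
set S := \sum_(_ < _ | _) _ => h.
have : S <= n.-1%:R * modulus q.[c].
  have -> : n.-1 = #|[pred i | i != Ordinal n0]|.
    by rewrite cardC1 card_ord.
  rewrite mulr_natl -sumr_const ler_sum// => j _; apply: cP.
  rewrite addrAC (le_trans (ler_modulusD _ _))// ComplexField.Normc.normcM.
  by rewrite modulusX (prim_root_modulus tn) expr1n mulr1 ud /d subrKC.
move=> Sn; have := qB _ cur; have := le_trans h (lerD (lexx _) Sn).
by rewrite -[in X in X <= _ -> _](prednK n0) mulrSr mulrDl mul1r addrC lerD2r => /le_trans; apply.
Qed.

End divided_difference.

Section poly_limit.
Context {R : realType}.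
Implicit Types (z w v y : R[i]) (f g : Cplx R -> Cplx R) (q : {poly R[i]}).

(** For an entire function this would follow from its Taylor series. Here it is drawn from the
    density of the polynomials and stands in for analyticity. *)
Definition poly_limit f := forall r e : R, 0 < e -> exists q : {poly R[i]},
  forall z, modulus z <= r -> modulus (f z - q.[z]) <= e.

Lemma ler_eps_mul (a b c : R) : 0 <= c ->
  (forall e, 0 < e -> a <= b + c * e) -> a <= b.
Proof.
move=> c0 H; apply/ler_addgt0Pr => e e0.
have c1 : 0 < c + 1 by rewrite ltr_wpDl.
apply: le_trans (H (e / (c + 1)) _) _; first by rewrite divr_gt0.
rewrite lerD2l mulrA ler_pdivrMr// mulrC ler_wpM2l ?lerDl// ltW//.
Qed.

Lemma poly_limit_sub f q : poly_limit f -> poly_limit (fun z => f z - q.[z]).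
Proof.
move=> fl r e e0; have [p pP] := fl r e e0; exists (p - q) => z /pP.
by rewrite hornerD hornerN opprB addrA addrNK.
Qed.

Lemma poly_limit_horner q : poly_limit (horner q).
Proof.
move=> r e e0; exists q => z _.
by rewrite subrr ComplexField.Normc.normc0 ltW.
Qed.

Lemma disc_sub z v (r : R) : modulus (z - v) <= r -> modulus z <= modulus v + r.
Proof.
by move=> zr; rewrite -[z](subrKC v) (le_trans (ler_modulusD _ _))// lerD2l.
Qed.

Lemma poly_limit_max_principle f v (r B : R) : poly_limit f -> 0 <= r ->
  (forall z, modulus (z - v) = r -> modulus (f z) <= B) ->
  forall z, modulus (z - v) <= r -> modulus (f z) <= B.
Proof.
move=> fl r0 fB z zr; apply: (@ler_eps_mul _ _ 2) => // e e0.
have [q qP] := fl (modulus v + r) e e0.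
have qB : modulus q.[z] <= B + e.
  apply: (poly_max_principle r0 _ zr) => y yr.
  have -> : q.[y] = f y - (f y - q.[y]) by rewrite subKr.
  rewrite (le_trans (ler_modulusD _ _))// lerD ?fB// normcN qP// disc_sub//.
  by rewrite yr.
rewrite -[f z](subrK q.[z]) (le_trans (ler_modulusD _ _))//.
have := qP z (disc_sub zr); lra.
Qed.

Lemma poly_limit_disc_bounded f (r : R) : poly_limit f ->
  exists2 B : R, 0 <= B & forall z, modulus z <= r -> modulus (f z) <= B.
Proof.
move=> fl; have [q qP] := fl r 1 ltr01.
have [B B0 qB] := poly_disc_bounded q 0 r.
exists (1 + B) => [|z zr]; first by rewrite addr_ge0.
rewrite -[f z](subrK q.[z]) (le_trans (ler_modulusD _ _))//.
by rewrite lerD ?qP// qB// subr0.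
Qed.

(** A Cauchy estimate: the bound is clear on the circle [|z - w| = del], and the maximum principle
    for the quotient [p] carries it inside. *)
Lemma poly_difference_quotient_le (p q : {poly R[i]}) w (del B : R) : 0 < del ->
  (forall z, q.[z] - q.[w] = p.[z] * (z - w)) ->
  (forall z, modulus (z - w) <= del -> modulus q.[z] <= B) ->
  forall z, modulus (z - w) <= del -> modulus p.[z] <= 2 * B / del.
Proof.
move=> del0 pE qB; apply: poly_max_principle; first exact: ltW.
move=> z zd; rewrite ler_pdivlMr// -zd -ComplexField.Normc.normcM -pE.
rewrite (le_trans (ler_modulusD _ _))// normcN mulr_natl mulr2n.
by rewrite lerD// qB ?zd// subrr ComplexField.Normc.normc0 ltW.
Qed.

Lemma difference_quotient_le f w (del B : R) : poly_limit f -> 0 < del ->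
  (forall z, modulus (z - w) <= del -> modulus (f z) <= B) ->
  forall z, z != w -> modulus (z - w) <= del ->
    modulus ((f z - f w) / (z - w)) <= 2 * B / del.
Proof.
move=> fl del0 fB z zw zd.
have m0 : 0 < modulus (z - w) by rewrite modulus_gt0 subr_eq0.
(* The first term is the cost of [|q| <= B + e] on the disc, the second that of replacing [f] by [q]
   in the quotient at the fixed point [z]. *)
apply: (@ler_eps_mul _ _ (2 / del + 2 / modulus (z - w))) => [|e e0].
  by rewrite addr_ge0 ?divr_ge0// ltW.
have [q qP] := fl (modulus w + del) e e0.
have [p pE] := poly_divided_difference q w.
have pB : modulus p.[z] <= 2 * (B + e) / del.
  apply: (poly_difference_quotient_le del0 pE _ zd) => y yd.
  have -> : q.[y] = f y - (f y - q.[y]) by rewrite subKr.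
  by rewrite (le_trans (ler_modulusD _ _))// lerD ?fB// normcN qP// disc_sub.
have zw0 : z - w != 0 by rewrite subr_eq0.
have -> : (f z - f w) / (z - w) =
    p.[z] + ((f z - q.[z]) - (f w - q.[w])) / (z - w).
  have -> : p.[z] = (q.[z] - q.[w]) / (z - w) by rewrite pE mulfK.
  by field.
rewrite (le_trans (ler_modulusD _ _))//.
rewrite [leRHS](_ : _ = 2 * (B + e) / del + 2 / modulus (z - w) * e); last first.
  by field; rewrite !gt_eqF.
rewrite lerD// ComplexField.Normc.normcM ComplexField.Normc.normcV mulrAC ler_pM2r ?invr_gt0//.
rewrite (le_trans (ler_modulusD _ _))// normcN mulr_natl mulr2n lerD// qP//.
  exact: disc_sub.
by rewrite lerDl ltW.
Qed.

(** Completeness with a rate. For a real sequence the intervals of radius [a n] around [t n] meet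
    pairwise, so the supremum of their left ends lies in all of them; the factor [2] comes from
    adding the real and imaginary parts. *)
Lemma complex_limit (s : nat -> R[i]) (a : nat -> R) :
  (forall n m, modulus (s n - s m) <= a n + a m) ->
  exists d, forall n, modulus (s n - d) <= 2 * a n.
Proof.
move=> sa.
have key (t : nat -> R) : (forall n m, `|t n - t m| <= a n + a m) ->
    exists d, forall n, `|t n - d| <= a n.
  move=> ta; pose E := range (fun n => t n - a n).
  have ub n : ubound E (t n + a n).
    move=> _ [m _ <-]; have := ta n m; rewrite ler_norml => /andP[]; lra.
  have hE : has_sup E.
    by split; [exists (t 0%N - a 0%N); exists 0%N|exists (t 0%N + a 0%N); exact: ub].
  exists (sup E) => n; rewrite ler_norml.
  have : t n - a n <= sup E by apply: sup_upper_bound => //; exists n.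
  have : sup E <= t n + a n by apply: ge_sup => //; exact: hE.1.
  by move=> ? ?; apply/andP; split; lra.
have RI n m : `|complex.Re (s n) - complex.Re (s m)| <= a n + a m /\
    `|complex.Im (s n) - complex.Im (s m)| <= a n + a m.
  have := sa n m; case: (s n) => x y; case: (s m) => x' y' xy.
  have [h1 h2] := Re_Im_le_modulus (x - x') (y - y').
  by split; [exact: le_trans h1 xy|exact: le_trans h2 xy].
have [d1 d1P] := key _ (fun n m => (RI n m).1).
have [d2 d2P] := key _ (fun n m => (RI n m).2).
exists (d1 +i* d2) => n.
have -> : s n - (d1 +i* d2) =
    (complex.Re (s n) - d1)%:C + 'i%C * (complex.Im (s n) - d2)%:C.
  by case: (s n) => x y; simpc.
rewrite (le_trans (ler_modulusD _ _))// mulr_natl mulr2n lerD//.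
  by rewrite /= expr0n addr0 sqrtr_sqr.
rewrite ComplexField.Normc.normcM /= !expr0n add0r expr1n sqrtr1 mul1r addr0.
by rewrite sqrtr_sqr.
Qed.

(** Taking difference quotients of the approximating polynomials twice gives a second-order estimate
    at [w] that is uniform in [n], so it survives the limit for each fixed [z]. *)
Lemma poly_limit_entire f : poly_limit f -> entire f.
Proof.
move=> fl w.
have [B B0 fB] := poly_limit_disc_bounded (modulus w + 1) fl.
pose e n : R := n.+1%:R^-1.
have e0 n : 0 < e n by rewrite invr_gt0.
have e1 n : e n <= 1 by rewrite invf_le1// ler1n.
have /choice[q qP] : forall n, exists q : {poly R[i]},
    forall z, modulus (z - w) <= 1 -> modulus (f z - q.[z]) <= e n.
  move=> n; have [q qP] := fl (modulus w + 1) _ (e0 n).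
  by exists q => z z1; apply: qP; exact: disc_sub.
have /choice[p pE] : forall n, exists p : {poly R[i]},
    forall z, (q n).[z] - (q n).[w] = p.[z] * (z - w).
  by move=> n; exact: poly_divided_difference.
have ww1 : modulus (w - w) <= 1 by rewrite subrr ComplexField.Normc.normc0.
(* [(p n).[w]] is the derivative of [q n] at [w]. These values form a Cauchy sequence by the Cauchy
   estimate for [q n - q m], and their limit [d] is the derivative of [f]. *)
have [n m|d dP] := @complex_limit (fun n => (p n).[w]) (fun n => 2 * e n).
  have -> : (p n).[w] - (p m).[w] = (p n - p m).[w] by rewrite hornerD hornerN.
  rewrite -mulrDr -[leRHS]divr1.
  apply: (@poly_difference_quotient_le _ (q n - q m)) ww1 => // z => [|z1].
    by rewrite !hornerD !hornerN mulrBl -!pE; ring.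
  rewrite hornerD hornerN.
  have -> : (q n).[z] - (q m).[z] = (f z - (q m).[z]) - (f z - (q n).[z]) by ring.
  by rewrite (le_trans (ler_modulusD _ _))// normcN addrC lerD ?qP.
(* [B + 1] bounds [q n] on the unit disc around [w], and each of the two difference quotients
   doubles the bound. *)
pose C := 4 * (B + 1).
have C0 : 0 < C by rewrite mulr_gt0// ltr_wpDl.
have main z : z != w -> modulus (z - w) <= 1 ->
    modulus ((f z - f w) / (z - w) - d) <= C * modulus (z - w).
  move=> zw z1; have m0 : 0 < modulus (z - w) by rewrite modulus_gt0 subr_eq0.
  have key n : modulus ((f z - f w) / (z - w) - d) <=
      C * modulus (z - w) + (4 + 2 / modulus (z - w)) * e n.
    have [p2 p2E] := poly_divided_difference (p n) w.
    have qB y : modulus (y - w) <= 1 -> modulus (q n).[y] <= B + 1.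
      move=> y1; have -> : (q n).[y] = f y - (f y - (q n).[y]) by rewrite subKr.
      rewrite (le_trans (ler_modulusD _ _))// lerD ?fB ?disc_sub//.
      by rewrite normcN (le_trans (qP _ _ y1)).
    have pB := poly_difference_quotient_le ltr01 (pE n) qB.
    have p2B := poly_difference_quotient_le ltr01 p2E pB z1.
    have zw0 : z - w != 0 by rewrite subr_eq0.
    have -> : (f z - f w) / (z - w) - d = p2.[z] * (z - w) + ((p n).[w] - d)
        + ((f z - (q n).[z]) - (f w - (q n).[w])) / (z - w).
      rewrite -p2E; have -> : (p n).[z] = ((q n).[z] - (q n).[w]) / (z - w).
        by rewrite pE mulfK.
      by field.
    rewrite (le_trans (ler_modulusD _ _))//.
    rewrite [leRHS](_ : _ = C * modulus (z - w) + 4 * e n +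
        2 / modulus (z - w) * e n); last by ring.
    rewrite lerD//.
      rewrite (le_trans (ler_modulusD _ _))// lerD//; last first.
        by rewrite (le_trans (dP n))//; lra.
      rewrite ComplexField.Normc.normcM ler_wpM2r ?modulus_ge0//.
      by rewrite (le_trans p2B)// /C; lra.
    rewrite ComplexField.Normc.normcM ComplexField.Normc.normcV mulrAC.
    rewrite ler_pM2r ?invr_gt0//.
    rewrite (le_trans (ler_modulusD _ _))// normcN mulr_natl mulr2n lerD// qP//.
  apply: (@ler_eps_mul _ _ (4 + 2 / modulus (z - w))) => [|t t0].
    by rewrite addr_ge0// divr_ge0// ltW.
  have [n] : exists n, e n <= t.
    have ti : 0 <= t^-1 by rewrite invr_ge0 ltW.
    exists (Num.bound t^-1); rewrite /e invf_ple ?posrE//.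
    by rewrite (le_trans (ltW (archi_boundP ti)))// ler_nat.
  move=> nt; apply: le_trans (key n) _; rewrite lerD2l ler_wpM2l//.
  by rewrite addr_ge0// divr_ge0// ltW.
suff [] : derivable f (w : Cplx R) 1 /\ 'D_1 f (w : Cplx R) = d by [].
apply: derivative_modulusE => t t0.
exists (Order.min 1 (t / C)) => [|z zw]; first by rewrite lt_min ltr01 divr_gt0.
rewrite lt_min => /andP[/ltW z1 zt].
by apply: le_lt_trans (main z zw z1) _; rewrite mulrC -ltr_pdivlMr.
Qed.

End poly_limit.

(** * Difference quotients and the operators [R_w] *)

Section difference_quotient.
Context {R : realType}.
Implicit Types (z w v y : R[i]) (f g : Cplx R -> Cplx R) (q : {poly R[i]}).

Definition diffq w f : Cplx R -> Cplx R :=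
  fun z => if z == w then 'D_1 f (w : Cplx R) else (f z - f w) / (z - w).

Lemma diffq0 f : diffq 0 f = @backward_shift R f.
Proof. by apply/funext => z; rewrite /diffq /backward_shift subr0. Qed.

Lemma diffqM w f z : diffq w f z * (z - w) = f z - f w.
Proof.
rewrite /diffq; case: eqVneq => [->|zw]; first by rewrite !subrr mulr0.
by rewrite divfK// subr_eq0.
Qed.

Lemma diffqE w f z : z != w -> diffq w f z = (f z - f w) / (z - w).
Proof. by rewrite /diffq => /negbTE ->. Qed.

Lemma near_point w (del : R) : 0 < del ->
  exists2 z, z != w & modulus (z - w) < del.
Proof.
move=> d0; exists (w + (del / 2)%:C).
  rewrite -subr_eq0 [w + _]addrC addrK -modulus_eq0 modulus_real ?divr_ge0 ?ltW//.
  by rewrite gt_eqF// divr_gt0.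
by rewrite [w + _]addrC addrK modulus_real ?divr_ge0 ?ltW//; lra.
Qed.

(** Carries estimates on the difference quotient off [w] over to the value that [diffq w f] takes at
    [w]. *)
Lemma derivative_near_poly f q w (del K : R) : derivable f (w : Cplx R) 1 ->
  0 < del ->
  (forall z, z != w -> modulus (z - w) <= del ->
    modulus ((f z - f w) / (z - w) - q.[z]) <= K) ->
  modulus ('D_1 f (w : Cplx R) - q.[w]) <= K.
Proof.
move=> df del0 qK; apply: (@ler_eps_mul _ _ _ 2) => // e e0.
have [d1 d10 d1P] := derivable_modulusP df e0.
have [d2 d20 d2P] := horner_modulusP q w e0.
have [|z zw] := @near_point w (Order.min del (Order.min d1 d2)).
  by rewrite !lt_min del0 d10.
rewrite !lt_min => /and3P[/ltW zd /(d1P _ zw) z1 /d2P z2].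
set Q := (f z - f w) / (z - w) in z1.
have -> : 'D_1 f (w : Cplx R) - q.[w] =
  (Q - q.[z]) - (Q - 'D_1 f (w : Cplx R)) + (q.[z] - q.[w]) by ring.
rewrite (le_trans (ler_modulusD _ _))//.
have := ler_modulusD (Q - q.[z]) (- (Q - 'D_1 f (w : Cplx R))).
by rewrite normcN; have := qK _ zw zd; rewrite -/Q; lra.
Qed.

Lemma diffq_le f w (del B : R) : poly_limit f -> 0 < del ->
  (forall z, modulus (z - w) <= del -> modulus (f z) <= B) ->
  forall z, modulus (z - w) <= del -> modulus (diffq w f z) <= 2 * B / del.
Proof.
move=> fl d0 fB z zd; have qB := difference_quotient_le fl d0 fB.
have [->|zw] := eqVneq z w; last by rewrite diffqE// qB.
have := @derivative_near_poly f 0 w del (2 * B / del) (@poly_limit_entire _ f fl w) d0.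
rewrite /diffq eqxx horner0 subr0; apply => y yw yd.
by rewrite horner0 subr0; exact: qB.
Qed.

Lemma diffq_far_le f w z (B : R) : modulus (f z) <= B -> modulus (f w) <= B ->
  1 <= modulus (z - w) -> modulus ((f z - f w) / (z - w)) <= 2 * B.
Proof.
move=> fz fw zw; rewrite ComplexField.Normc.normcM ComplexField.Normc.normcV.
rewrite ler_pdivrMr ?(lt_le_trans ltr01)//.
have B0 : 0 <= B by exact: le_trans (modulus_ge0 _) fz.
apply: (@le_trans _ _ (2 * B)); last by rewrite ler_peMr// mulr_ge0.
by rewrite (le_trans (ler_modulusD _ _))// normcN mulr_natl mulr2n lerD.
Qed.

Lemma poly_limit_diffq w f : poly_limit f -> poly_limit (diffq w f).
Proof.
(* [rho] is large enough for the disc of radius [rho] to contain the unit disc around [w]: there the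
   Cauchy estimate applies to [f - q], and farther away the denominator has modulus at least [1].
   Both cases double the error, hence [e / 2]. *)
move=> fl r e e0; pose rho := Order.max r (modulus w + 1).
have [|q qP] := fl rho (e / 2); first by rewrite divr_gt0.
have [p pE] := poly_divided_difference q w; exists p.
have wr : modulus w <= rho by rewrite le_max; apply/orP; right; lra.
have off z : z != w -> modulus z <= rho ->
    modulus ((f z - f w) / (z - w) - p.[z]) <= e.
  move=> zw zr; have zw0 : z - w != 0 by rewrite subr_eq0.
  have -> : (f z - f w) / (z - w) - p.[z] =
      ((f z - q.[z]) - (f w - q.[w])) / (z - w).
    have -> : p.[z] = (q.[z] - q.[w]) / (z - w) by rewrite pE mulfK.
    by field.
  have eE : e = 2 * (e / 2) by rewrite mulrC divfK.
  rewrite eE; have [zw1|/ltW zw1] := leP (modulus (z - w)) 1.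
    rewrite -[leRHS]divr1.
    apply: (difference_quotient_le (poly_limit_sub q fl) ltr01 _ zw zw1) => y yw.
    apply: qP; rewrite le_max; apply/orP; right; exact: disc_sub.
  apply: (diffq_far_le (f := fun z => f z - q.[z])) => //; exact: qP.
move=> z zr; have [->|zw] := eqVneq z w.
  rewrite /diffq eqxx; apply: (@derivative_near_poly f p w 1) => //.
    exact: poly_limit_entire.
  move=> y yw y1; apply: off => //.
  by rewrite le_max; apply/orP; right; exact: disc_sub.
by rewrite diffqE// off// le_max zr.
Qed.

Lemma poly_limit_lin (a : R[i]) f g : poly_limit f -> poly_limit g ->
  poly_limit (fun z => a * f z + g z).
Proof.
move=> fl gl r e e0; have a1 : 0 < modulus a + 1 by rewrite ltr_wpDl// modulus_ge0.
have [|p pP] := fl r (e / 2 / (modulus a + 1)); first by rewrite !divr_gt0.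
have [|q qP] := gl r (e / 2); first by rewrite divr_gt0.
exists (a *: p + q) => z zr; rewrite hornerD hornerZ.
have -> : a * f z + g z - (a * p.[z] + q.[z]) =
  a * (f z - p.[z]) + (g z - q.[z]) by ring.
rewrite (le_trans (ler_modulusD _ _))// [leRHS]splitr lerD ?qP//.
rewrite ComplexField.Normc.normcM (@le_trans _ _ ((modulus a + 1) * (e / 2 / (modulus a + 1))))//.
  by rewrite ler_pM ?modulus_ge0 ?pP// lerDl.
by rewrite mulrC divfK// gt_eqF.
Qed.

(** Off [w] the factor cancels. At [w], the difference quotient bound gives [|f w| <= 2 B |y - w|]
    for [y] close to [w], as [f y = 0]. *)
Lemma poly_limit_cancel f w : poly_limit f -> (forall z, f z * (z - w) = 0) ->
  forall z, f z = 0.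
Proof.
move=> fl f0; have off z : z != w -> f z = 0.
  by move=> zw; have /eqP := f0 z; rewrite mulf_eq0 subr_eq0 (negbTE zw) orbF => /eqP.
move=> z; have [->|] := eqVneq z w; last exact: off.
have [B B0 fB] := poly_limit_disc_bounded (modulus w + 1) fl.
apply/eqP; rewrite -modulus_eq0 eq_le modulus_ge0 andbT.
apply: (@ler_eps_mul _ _ _ (2 * B)) => [|e e0]; first by rewrite mulr_ge0.
have [|y yw] := @near_point w (Order.min 1 e); first by rewrite lt_min ltr01.
rewrite lt_min => /andP[/ltW y1 /ltW ye].
have := @difference_quotient_le _ f w 1 B fl ltr01 (fun z zw => fB z (disc_sub zw)) y yw y1.
rewrite (off _ yw) sub0r ComplexField.Normc.normcM ComplexField.Normc.normcV.
rewrite normcN divr1 ler_pdivrMr ?modulus_gt0 ?subr_eq0// => /le_trans; apply.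
by rewrite add0r ler_wpM2l// mulr_ge0.
Qed.

(** This makes the algebra of the operators [R_w] a matter of multiplying by [z - w]. *)
Lemma diffq_unique w f g : poly_limit f -> poly_limit g ->
  (forall z, g z * (z - w) = f z - f w) -> g = diffq w f.
Proof.
move=> fl gl gE; apply/funext => z; apply/eqP; rewrite -subr_eq0; apply/eqP.
have := @poly_limit_cancel (fun z => -1 * diffq w f z + g z) w.
move=> /(_ _ _ z); rewrite mulN1r addrC; apply.
  by apply: poly_limit_lin => //; exact: poly_limit_diffq.
by move=> y; rewrite mulrDl gE -mulrA diffqM mulN1r addNr.
Qed.

Lemma diffq_lin w a f g : poly_limit f -> poly_limit g ->
  diffq w (fun z => a * f z + g z) = (fun z => a * diffq w f z + diffq w g z).
Proof.
move=> fl gl; apply/esym/diffq_unique.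
- exact: poly_limit_lin.
- by apply: poly_limit_lin; exact: poly_limit_diffq.
by move=> z; rewrite mulrDl -mulrA !diffqM; ring.
Qed.

(** The resolvent identity [R_v - R_w = (v - w) R_w R_v]. *)
Lemma diffq_resolvent w v f : poly_limit f ->
  diffq v f = (fun z => (v - w) * diffq w (diffq v f) z + diffq w f z).
Proof.
move=> fl; have vl := poly_limit_diffq v fl; set g := diffq v f in vl *.
have -> : diffq w f = fun z => - (v - w) * diffq w g z + g z.
  apply/esym/diffq_unique => //.
    by apply: poly_limit_lin => //; exact: poly_limit_diffq.
  move=> z; have := diffqM v f w; have := diffqM v f z; rewrite -/g => gz gw.
  have -> : f z - f w = (f z - f v) - (f w - f v) by ring.
  by rewrite -gz -gw mulrDl -mulrA diffqM; ring.
by apply/funext => z; ring.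
Qed.

(** [diffq 0] lowers the growth exponent by one. When it reaches [0], the maximum principle makes
    [f] bounded, and the Cauchy estimate on ever larger discs makes it constant. *)
Lemma liouville_poly f N (C r0 : R) : poly_limit f ->
  (forall z, r0 <= modulus z -> modulus (f z) <= C * modulus z ^+ N) ->
  exists q : {poly R[i]}, f = horner q.
Proof.
elim: N f C r0 => [|N ih] f C r0 fl fC.
  exists (f 0)%:P; apply/funext => z; rewrite hornerC.
  apply/eqP; rewrite -subr_eq0 -modulus_eq0 eq_le modulus_ge0 andbT.
  have [->|z0] := eqVneq z 0; first by rewrite subrr ComplexField.Normc.normc0.
  have m0 : 0 < modulus z by rewrite modulus_gt0.
  have C0 : 0 <= C.
    rewrite (le_trans (modulus_ge0 (f `|r0|%:C)))//.
    by have := fC `|r0|%:C; rewrite expr0 mulr1; apply; rewrite modulus_real// ler_norm.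
  have fB y : modulus (f y) <= C.
    pose r := Order.max `|r0| (modulus y).
    have rr : 0 <= r by rewrite le_max normr_ge0.
    apply: (@poly_limit_max_principle _ f 0 r C fl rr) => [x|].
      rewrite subr0 => xr; rewrite -[C]mulr1 -(expr0 (modulus x)) fC// xr.
      by rewrite le_max ler_norm.
    by rewrite subr0 le_max lexx orbT.
  apply: (@ler_eps_mul _ _ _ (2 * C * modulus z)) => [|e e0].
    by rewrite !mulr_ge0// modulus_ge0.
  (* Large enough to have [z] in the disc of radius [del] and [1 / del <= e]. *)
  pose del := modulus z + e^-1.
  have ei : 0 < e^-1 by rewrite invr_gt0.
  have del0 : 0 < del by rewrite addr_gt0.
  have := @difference_quotient_le _ f 0 del C fl del0 (fun y _ => fB y) z z0.
  rewrite subr0 => /(_ _); rewrite /del lerDl ltW// => /(_ isT).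
  rewrite ComplexField.Normc.normcM ComplexField.Normc.normcV ler_pdivrMr//.
  move=> /le_trans; apply; rewrite add0r mulrAC ler_wpM2l//.
    by rewrite !mulr_ge0// modulus_ge0.
  by rewrite invf_ple ?posrE// /del lerDr modulus_ge0.
have [|q qE] := ih (diffq 0 f) (C + modulus (f 0)) (Order.max r0 1) (poly_limit_diffq 0 fl).
  move=> z; rewrite ge_max => /andP[zr z1].
  have z0 : z != 0 by rewrite -modulus_gt0 (lt_le_trans ltr01).
  rewrite diffqE// subr0 ComplexField.Normc.normcM ComplexField.Normc.normcV.
  rewrite ler_pdivrMr ?modulus_gt0// -mulrA -exprSr.
  rewrite (le_trans (ler_modulusD _ _))// normcN mulrDl lerD ?fC//.
  by rewrite ler_peMr ?modulus_ge0// exprn_ege1.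
exists ((f 0)%:P + q * 'X); apply/funext => z.
by rewrite hornerD hornerC hornerMX -qE -[X in _ * X]subr0 diffqM addrC subrK.
Qed.

End difference_quotient.

(** * The Fock space *)

Section continuous_measurability.
Context {R : realType}.
Local Notation mR := (measurableTypeR R).
Local Notation cx := (@complex_of_pair R).

(** The sigma-algebra is the product one, so the open set is written as a countable union of boxes
    with rational centres; [F a b n] is either such a box or empty. *)
Lemma open_measurable_plane (A : set (R * R)) :
  open A -> measurable (A : set (mR * mR)).
Proof.
move=> oA.
pose e n : R := n.+1%:R^-1.
pose box a b n : set (R * R) := ball (ratr a : R) (e n) `*` ball (ratr b : R) (e n).
pose F a b n : set (R * R) := [set w | box a b n w /\ box a b n `<=` A].
have -> : A = \bigcup_(a : rat) \bigcup_(b : rat) \bigcup_n F a b n.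
  apply/seteqP; split; last first.
    by move=> w [a _ [b _ [n _ [wb]]]]; exact.
  move=> [x y] Axy; move: oA; rewrite openE => /(_ _ Axy)/nbhs_ballP[d/= d0 dA].
  have [n ne] : exists n, e n < d / 2.
    have [n nd] : exists n, (d / 2)^-1 < n%:R.
      exists (Num.bound (d / 2)^-1); apply: archi_boundP.
      by rewrite invr_ge0 divr_ge0// ltW.
    exists n; rewrite /e invf_plt ?posrE ?divr_gt0// (lt_le_trans nd)// ler_nat.
    exact: leqnSn.
  have en0 : 0 < e n by rewrite invr_gt0.
  have [a ax] : exists a : rat, ratr a \in `](x - e n), (x + e n)[.
    by apply: rat_in_itvoo; lra.
  have [b bx] : exists b : rat, ratr b \in `](y - e n), (y + e n)[.
    by apply: rat_in_itvoo; lra.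
  rewrite !in_itv/= in ax bx.
  exists a => //; exists b => //; exists n => //; split.
    by split; rewrite /ball/=/ball_/= ltr_distlC; apply/andP; lra.
  move=> [u v] [/=]; rewrite /ball/=/ball_/= !ltr_distlC => /andP[u1 u2] /andP[v1 v2].
  apply: dA; split; rewrite /ball/=/ball_/= ltr_distlC; apply/andP; lra.
apply: bigcupT_measurable_rat => a; apply: bigcupT_measurable_rat => b.
apply: bigcupT_measurable => n.
have mbox : measurable (box a b n : set (mR * mR)).
  by apply: measurableX; exact: measurable_ball.
have [bA|bA] := pselect (box a b n `<=` A).
  by rewrite (_ : F a b n = box a b n)//; apply/seteqP; split => // w [].
by rewrite (_ : F a b n = set0)//; apply/seteqP; split => // w [].
Qed.

Lemma continuous_measurable_plane (g : R * R -> R) :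
  continuous g -> measurable_fun setT (g : mR * mR -> mR).
Proof.
move=> cg mT; apply: (measurability _ (RGenOInfty.measurableE R)) => //.
move=> _ [_ [a ->] <-]; rewrite setTI; apply: open_measurable_plane.
by move/continuousP : cg; apply; exact: interval_open.
Qed.

Lemma entire_continuous (f : Cplx R -> Cplx R) : entire f -> continuous f.
Proof.
move=> fe w A /nbhs_modulusP[e e0 eA]; apply/nbhs_modulusP.
have [d d0 dP] := derivable_modulusP (fe w) ltr01.
set D := 'D_1 f w in dP; pose C := modulus D + 1.
have C0 : 0 < C by rewrite ltr_wpDl// modulus_ge0.
exists (Order.min d (e / C)) => [|z]; first by rewrite lt_min d0 divr_gt0.
rewrite lt_min => /andP[zd ze]; apply: eA.
have [->|zw] := eqVneq z w; first by rewrite subrr ComplexField.Normc.normc0.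
have zw0 : z - w != 0 by rewrite subr_eq0.
have -> : f z - f w = ((f z - f w) / (z - w) - D + D) * (z - w).
  by rewrite subrK divfK.
rewrite ComplexField.Normc.normcM (@le_lt_trans _ _ (C * modulus (z - w)))//.
  rewrite ler_wpM2r ?modulus_ge0// (le_trans (ler_modulusD _ _))//.
  by rewrite addrC lerD2l ltW// dP.
by rewrite mulrC -ltr_pdivlMr.
Qed.

Lemma entire_modulusP (f : Cplx R -> Cplx R) (w : R[i]) (e : R) : entire f ->
  0 < e -> exists2 d : R, 0 < d &
    forall z, modulus (z - w) < d -> modulus (f z - f w) < e.
Proof.
move=> fe e0; have : nbhs (f w) [set y | modulus (y - f w) < e].
  by apply/nbhs_modulusP; exists e.
by move=> /(entire_continuous fe)/nbhs_modulusP[d d0 dP]; exists d.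
Qed.

Lemma measurable_modulus_entire (f : Cplx R -> Cplx R) : entire f ->
  measurable_fun setT (fun w : plane R => modulus (f (to_Cplx w)) : R).
Proof.
move=> fe.
have cf : continuous (fun w : R * R => modulus (f (cx w))).
  rewrite (_ : (fun w => _) = (fun y : Cplx R => modulus (y - 0)) \o
      (f \o (cx : R * R -> Cplx R))).
    move=> w; apply: continuous_comp; last exact: modulusB_continuous.
    apply: continuous_comp; first exact: complex_of_pair_continuous.
    exact: entire_continuous.
  by apply/funext => w /=; rewrite subr0.
have mf := continuous_measurable_plane cf.
move=> _ A mA; have := mf measurableT A mA; rewrite !setTI.
exact: plane_measurable.
Qed.

Lemma entire_lin (a : R[i]) (f g : Cplx R -> Cplx R) : entire f -> entire g ->
  entire (fun z => a * f z + g z).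
Proof.
move=> fe ge w.
suff : derivable ((a *: f) + g) w 1 by [].
by apply: derivableD; [exact: derivableZ|].
Qed.

Lemma entire_horner (q : {poly R[i]}) : entire (horner q : Cplx R -> Cplx R).
Proof. exact/poly_limit_entire/poly_limit_horner. Qed.

End continuous_measurability.

Lemma powR_le_inv (R : realType) (p a b : R) : 0 < p -> 0 <= a -> 0 <= b ->
  a `^ p <= b `^ p -> a <= b.
Proof.
move=> p0 a0 b0; rewrite leNgt; apply: contraNle => ba.
by rewrite gt0_ltr_powR.
Qed.

(** Both this bound and the next compare with a single number, here the maximum, there the sum.
    Together they replace Minkowski's inequality at the cost of a factor [3 * 3]. *)
Lemma powR_add3_le (R : realType) (p a b c : R) : 1 <= p ->
  0 <= a -> 0 <= b -> 0 <= c ->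
  (a + b + c) `^ p <= 3 `^ p * (a `^ p + b `^ p + c `^ p).
Proof.
move=> p1 a0 b0 c0; have p0 : 0 <= p by rewrite (le_trans ler01).
pose m := Order.max a (Order.max b c).
have [am bm cm] : [/\ a <= m, b <= m & c <= m].
  by rewrite /m !le_max !lexx !orbT.
have m0 : 0 <= m by exact: le_trans am.
have mp : m `^ p <= a `^ p + b `^ p + c `^ p.
  have := powR_ge0 a p; have := powR_ge0 b p; have := powR_ge0 c p.
  rewrite /m; case: (leP b c) => _; last by case: (leP a b) => _; lra.
  by case: (leP a c) => _; lra.
apply: (@le_trans _ _ ((3 * m) `^ p)); last first.
  by rewrite powRM// ler_wpM2l ?powR_ge0.
by rewrite ge0_ler_powR ?nnegrE ?addr_ge0 ?mulr_ge0//; lra.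
Qed.

Lemma powR_le_add3 (R : realType) (p a b c : R) : 1 <= p ->
  0 <= a -> 0 <= b -> 0 <= c ->
  a `^ p + b `^ p + c `^ p <= (3 * (a + b + c)) `^ p.
Proof.
move=> p1 a0 b0 c0; have p0 : 0 <= p by rewrite (le_trans ler01).
have s0 : 0 <= a + b + c by rewrite !addr_ge0.
have key x : 0 <= x -> x <= a + b + c -> x `^ p <= (a + b + c) `^ p.
  by move=> x0 xs; rewrite ge0_ler_powR ?nnegrE.
have ka : a `^ p <= (a + b + c) `^ p by apply: key => //; lra.
have kb : b `^ p <= (a + b + c) `^ p by apply: key => //; lra.
have kc : c `^ p <= (a + b + c) `^ p by apply: key => //; lra.
have k3 : 3 * (a + b + c) `^ p <= (3 * (a + b + c)) `^ p.
  rewrite powRM// ler_wpM2r ?powR_ge0// -[leLHS]powRr1// ler_powR// ler1n//.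
by apply: le_trans k3; lra.
Qed.

Section integral_domination.
Context d (T : measurableType d) (R : realType).
Context (mu : {measure set T -> \bar R}).

Lemma ge0_integral_le_scale (f g : T -> R) (k : R) : 0 <= k ->
  measurable_fun setT f -> (forall x, 0 <= f x) -> (forall x, 0 <= g x) ->
  (forall x, g x <= k * f x) ->
  (\int[mu]_x (g x)%:E <= k%:E * \int[mu]_x (f x)%:E)%E.
Proof.
move=> k0 mf f0 g0 gf; rewrite -ge0_integralZl//.
- by apply: ge0_le_integralT => x; rewrite -?EFinM lee_fin ?g0 ?gf.
- exact/measurable_EFinP.
- by move=> x _; rewrite lee_fin.
Qed.

Lemma ge0_integral_le_add (f g h k : T -> R) (c : R) : 0 <= c ->
  measurable_fun setT f -> measurable_fun setT h -> measurable_fun setT k ->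
  (forall x, 0 <= f x) -> (forall x, 0 <= g x) -> (forall x, 0 <= h x) ->
  (forall x, 0 <= k x) -> (forall x, g x <= c * (f x + h x + k x)) ->
  (\int[mu]_x (g x)%:E <= c%:E *
   (\int[mu]_x (f x)%:E + \int[mu]_x (h x)%:E + \int[mu]_x (k x)%:E))%E.
Proof.
move=> c0 mf mh mk f0 g0 h0 k0 gfh.
have E (u v : T -> R) : measurable_fun setT u -> measurable_fun setT v ->
    (forall x, 0 <= u x) -> (forall x, 0 <= v x) ->
    (\int[mu]_x (u x)%:E + \int[mu]_x (v x)%:E = \int[mu]_x (u x + v x)%:E)%E.
  move=> mu' mv u0 v0; rewrite -ge0_integralD//.
  - by move=> x _; rewrite lee_fin.
  - exact/measurable_EFinP.
  - by move=> x _; rewrite lee_fin.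
  - exact/measurable_EFinP.
have mfh : measurable_fun setT (fun x => f x + h x) by exact: measurable_funD.
rewrite E// E//; last by move=> x; rewrite addr_ge0.
apply: (@ge0_integral_le_scale (fun x => f x + h x + k x)) => //.
  exact: measurable_funD.
by move=> x; rewrite !addr_ge0.
Qed.

Lemma ge0_integral_ge_measure (A : set T) (f : T -> R) (k : R) : 0 <= k ->
  measurable A -> (forall x, 0 <= f x) -> (forall x, A x -> k <= f x) ->
  (k%:E * mu A <= \int[mu]_x (f x)%:E)%E.
Proof.
move=> k0 mA f0 kf; rewrite -[A]setIT -integral_indic// -ge0_integralZl//.
- apply: ge0_le_integralT => x; rewrite -EFinM lee_fin indicE.
    by rewrite mulr_ge0.
  have [/set_mem Ax|_] := boolP (_ \in _); last by rewrite mulr0.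
  by rewrite mulr1 kf.
- by apply/measurable_EFinP; exact: measurable_indic.
Qed.

End integral_domination.

Section fock_space.
Context {R : realType} (p : R) (W : Cplx R -> R).
Context (hp : 1 <= p) (hW : weight W).
Implicit Types (z w v y : R[i]) (f g h : Cplx R -> Cplx R) (q : {poly R[i]}).
Local Notation I := (fock_integral p W).
Local Notation fock := (fock p W).
Local Notation mR := (measurableTypeR R).

Definition fnorm f : R := fine (fock_norm p W f).
Local Notation N := fnorm.

Let p0 : 0 < p. Proof. exact: lt_le_trans hp. Qed.

Let W0 z : 0 < W z. Proof. by case: hW. Qed.

Lemma integrand_ge0 f z : 0 <= modulus (f z) `^ p * W z.
Proof. by rewrite mulr_ge0 ?powR_ge0// ltW. Qed.

Lemma fock_integral_ge0 f : (0 <= I f)%E.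
Proof. by apply: integral_ge0 => w _; rewrite lee_fin integrand_ge0. Qed.

Lemma measurable_integrand f : entire f -> measurable_fun setT
  (fun w : plane R => modulus (f (to_Cplx w)) `^ p * W (to_Cplx w)).
Proof.
move=> fe; apply: measurable_funM; last by case: hW.
apply: (measurableT_comp (measurable_powR _)).
exact: measurable_modulus_entire.
Qed.

Lemma fnorm_ge0 f : 0 <= N f.
Proof. by rewrite fine_ge0// poweR_ge0. Qed.

Lemma fock_integral_fin f : fock f -> I f \is a fin_num.
Proof. by move=> [_ If]; rewrite ge0_fin_numE// fock_integral_ge0. Qed.

Lemma fock_normE f : fock f -> fock_norm p W f = (N f)%:E.
Proof.
by move=> ff; rewrite /N fineK// /fock_norm -(fineK (fock_integral_fin ff)) poweR_EFin.
Qed.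

Lemma fnormE f : N f = fine (I f) `^ p^-1.
Proof. by rewrite /N /fock_norm fine_poweR. Qed.

Lemma fock_integralE f : fock f -> I f = (N f `^ p)%:E.
Proof.
move=> ff; rewrite fnormE -powRrM mulVf ?gt_eqF// powRr1.
  by rewrite fineK// fock_integral_fin.
by rewrite fine_ge0// fock_integral_ge0.
Qed.

(** The one passage from pointwise bounds to membership and norm. Three dominating functions are
    allowed because the final estimate uses [f], [1] and a monomial. *)
Lemma fock_dom g f h k (c : R) : entire g -> fock f -> fock h -> fock k -> 0 <= c ->
  (forall z, modulus (g z) <= c * (modulus (f z) + modulus (h z) + modulus (k z))) ->
  fock g /\ N g <= 9 * c * (N f + N h + N k).
Proof.
move=> ge ff fh fk c0 gc.
have le1 : (I g <= ((3 * c) `^ p)%:E * (I f + I h + I k))%E.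
  apply: (@ge0_integral_le_add _ _ _ (@m2 R)
    (fun t => modulus (f (to_Cplx t)) `^ p * W (to_Cplx t))
    (fun t => modulus (g (to_Cplx t)) `^ p * W (to_Cplx t))
    (fun t => modulus (h (to_Cplx t)) `^ p * W (to_Cplx t))
    (fun t => modulus (k (to_Cplx t)) `^ p * W (to_Cplx t))).
  - exact: powR_ge0.
  - by apply: measurable_integrand; case: ff.
  - by apply: measurable_integrand; case: fh.
  - by apply: measurable_integrand; case: fk.
  - by move=> w; exact: integrand_ge0.
  - by move=> w; exact: integrand_ge0.
  - by move=> w; exact: integrand_ge0.
  - by move=> w; exact: integrand_ge0.
  move=> w; rewrite -!mulrDl mulrA; apply: ler_wpM2r; first exact: ltW.
  set x := to_Cplx w.
  apply: (@le_trans _ _ ((c * (modulus (f x) + modulus (h x) + modulus (k x))) `^ p)).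
    by rewrite ge0_ler_powR ?nnegrE ?(ltW p0) ?modulus_ge0 ?mulr_ge0 ?addr_ge0 ?modulus_ge0.
  rewrite [leLHS]powRM ?addr_ge0 ?modulus_ge0// [3 * c]mulrC [(c * 3) `^ p]powRM//.
  rewrite -mulrA ler_wpM2l ?powR_ge0//.
  by apply: powR_add3_le; rewrite ?modulus_ge0.
have fg : fock g.
  split=> //; apply: le_lt_trans le1 _.
  by rewrite (fock_integralE ff) (fock_integralE fh) (fock_integralE fk) -!EFinD -EFinM ltry.
split=> //; move: le1.
rewrite (fock_integralE ff) (fock_integralE fh) (fock_integralE fk) (fock_integralE fg).
have := fnorm_ge0 f; have := fnorm_ge0 h; have := fnorm_ge0 k; have := fnorm_ge0 g.
move: (N f) (N g) (N h) (N k) => a b e d b0 d0 e0 a0.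
rewrite -!EFinD -EFinM lee_fin => le1.
have -> : 9 * c * (a + e + d) = 3 * c * (3 * (a + e + d)) by ring.
apply: (powR_le_inv p0) => //; first by rewrite !mulr_ge0// !addr_ge0.
rewrite [leRHS]powRM ?mulr_ge0 ?addr_ge0// (le_trans le1)//.
by rewrite ler_wpM2l ?powR_ge0// powR_le_add3.
Qed.

Lemma weight_lower_bound (r : R) : exists2 a : R, 0 < a &
  forall z, modulus z <= r -> a <= W z.
Proof.
case: hW => _ _ /(_ _ (@compact_disc R 0 r))[a [b [a0 ab]]].
exists a => // z zr; have /andP[] // : a <= W z <= b.
by apply: ab; rewrite /= subr0.
Qed.

Lemma poly_point_evaluation (r : R) : exists2 C : R, 0 <= C &
  forall q v, fock (horner q) -> modulus v <= r ->
    modulus q.[v] <= C * N (horner q).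
Proof.
have [a a0 aW] := weight_lower_bound (r + 1).
pose b := fine (@disc_area R).
have bE : disc_area = b%:E.
  by rewrite fineK// ge0_fin_numE ?disc_area_lty// ltW// disc_area_gt0.
have b0 : 0 < b by rewrite -lte_fin -bE disc_area_gt0.
(* With [b] the area of the unit disc and [a] a lower bound of [W], the area mean gives
   [(|q v| / 2)^p b <= N^p / a]. *)
exists (2 * (a * b)^-1 `^ p^-1) => [|q v qf vr]; first by rewrite mulr_ge0// powR_ge0.
have mq : measurable_fun setT (fun w : mR * mR =>
    modulus q.[complex_of_pair w] `^ p * unit_disc_indicator (complex_of_pair w - v) : R).
  apply: measurable_funM.
    apply: (measurableT_comp (measurable_powR _)).
    exact: (@measurable_modulus_horner _ _ (mR * mR)%type fst snd).
  exact: (@measurable_unit_disc_indicator _ _ (mR * mR)%type fst snd).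
have := area_mean q v hp; rewrite bE -EFinM -integral_m2_borelE; last 2 first.
- exact/measurable_EFinP.
- by move=> w; rewrite lee_fin mulr_ge0 ?powR_ge0 ?unit_disc_indicator_ge0.
set J := (\int[_]_w _)%E => bJ.
have J0 : (0 <= J)%E.
  by apply: integral_ge0 => w _; rewrite lee_fin mulr_ge0 ?powR_ge0 ?unit_disc_indicator_ge0.
have JI : (J <= a^-1%:E * I (horner q))%E.
  apply: (@ge0_integral_le_scale _ _ _ (@m2 R)
    (fun t => modulus q.[to_Cplx t] `^ p * W (to_Cplx t))).
  - by rewrite invr_ge0 ltW.
  - by apply: measurable_integrand; case: qf.
  - by move=> w; exact: integrand_ge0.
  - by move=> w; rewrite mulr_ge0 ?powR_ge0 ?unit_disc_indicator_ge0.
  move=> w; rewrite mulrCA; apply: ler_wpM2l; first exact: powR_ge0.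
  rewrite mulrC ler_pdivlMr// mulrC.
  rewrite /unit_disc_indicator; have [wv|wv] := leP (modulus _) 1; last first.
    by rewrite mulr0 ltW.
  by rewrite mulr1 aW// (le_trans (disc_sub wv))// lerD2r.
have := le_trans bJ JI; rewrite (fock_integralE qf) -EFinM lee_fin.
have := fnorm_ge0 (horner q); move: (N (horner q)) => n n0.
rewrite -ler_pdivlMr// mulrAC -invfM => h.
have iab : 0 <= (a * b)^-1 by rewrite invr_ge0 mulr_ge0// ltW.
set k := (a * b)^-1 `^ p^-1.
have kp : (a * b)^-1 = k `^ p by rewrite -powRrM mulVf ?gt_eqF// powRr1.
rewrite kp -powRM ?powR_ge0// in h.
have := powR_le_inv p0 _ _ h.
rewrite !mulr_ge0 ?divr_ge0 ?modulus_ge0 ?powR_ge0// => /(_ isT isT).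
by rewrite ler_pdivrMr// mulrC mulrA.
Qed.

End fock_space.

Section fock_approximation.
Context {R : realType} (p : R) (W : Cplx R -> R).
Context (hp : 1 <= p) (hW : weight W).
Context (hpoly : fock_dense p W (@polynomials R)).
Implicit Types (z w v y : R[i]) (f g h : Cplx R -> Cplx R) (q : {poly R[i]}).
Local Notation I := (fock_integral p W).
Local Notation fock := (fock p W).
Local Notation N := (fnorm p W).
Local Notation mR := (measurableTypeR R).

Let p0 : 0 < p. Proof. exact: lt_le_trans hp. Qed.

Lemma fock_horner q : fock (horner q).
Proof. by apply: hpoly.1; exists q. Qed.

Lemma fock_entire f : fock f -> entire f.
Proof. by case. Qed.

Lemma fock_lin a f g : fock f -> fock g -> fock (fun z => a * f z + g z).
Proof.
move=> ff fg; have c0 : 0 <= modulus a + 1 by rewrite addr_ge0 ?modulus_ge0.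
apply: (@fock_dom _ _ _ hp hW _ f g g (modulus a + 1) _ ff fg fg c0 _).1.
  by apply: entire_lin; exact: fock_entire.
move=> z; apply: (@le_trans _ _ ((modulus a + 1) * (modulus (f z) + modulus (g z)))); last first.
  by rewrite ler_wpM2l// lerDl modulus_ge0.
rewrite (le_trans (ler_modulusD _ _))// ComplexField.Normc.normcM mulrDr.
by rewrite lerD// ?ler_wpM2r ?lerDl ?ler_peMl ?modulus_ge0// lerDr modulus_ge0.
Qed.

Lemma fock_sub f g : fock f -> fock g -> fock (fun z => f z - g z).
Proof.
move=> ff fg; rewrite (_ : (fun z => _) = (fun z => -1 * g z + f z)).
  exact: fock_lin.
by apply/funext => z; rewrite mulN1r addrC.
Qed.

Lemma fock_dense_poly f (e : R) : fock f -> 0 < e ->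
  exists q, N (fun z => f z - q.[z]) < e.
Proof.
move=> ff e0; have [g [q ->]] := hpoly.2 f ff e e0.
have fs := fock_sub ff (fock_horner q).
have -> : (f \- horner q)%R = (fun z => f z - q.[z]) by [].
by rewrite (fock_normE hW fs) lte_fin => qe; exists q.
Qed.

(** The square of half-side [d / 3] around [v] lies in the disc of radius [d], and the weight is
    bounded below there. The lemma prevents functions of arbitrarily small norm from staying away
    from [0] on a fixed disc. *)
Lemma fock_lower_bound v (d c : R) : 0 < d -> 0 < c ->
  exists2 k : R, 0 < k & forall g, fock g ->
    (forall z, modulus (z - v) < d -> c <= modulus (g z)) -> k <= N g.
Proof.
move=> d0 c0; case: v => x y.
have [a a0 aW] := weight_lower_bound hW (modulus (x +i* y) + d).
pose Q : set (mR * mR) :=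
  `](x - d / 3), (x + d / 3)]%classic `*` `](y - d / 3), (y + d / 3)]%classic.
have mQ : measurable Q by exact: measurableX.
pose m := (x + d / 3 - (x - d / 3)) * (y + d / 3 - (y - d / 3)).
have m0 : 0 < m by rewrite /m mulr_gt0//; lra.
have QE : @borel_m2 R Q = m%:E by rewrite borel_m2_square//; lra.
have K0 : 0 < c `^ p * a * m by rewrite mulr_gt0// mulr_gt0// powR_gt0.
exists ((c `^ p * a * m) `^ p^-1); first by rewrite powR_gt0.
move=> h fh hc; apply: (powR_le_inv p0); rewrite ?powR_ge0 ?fnorm_ge0//.
rewrite -powRrM mulVf ?gt_eqF// powRr1 ?(ltW K0)// -lee_fin -fock_integralE//.
rewrite EFinM -QE -m2_borelE//.
apply: (@ge0_integral_ge_measure _ _ _ (@m2 R) Q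
  (fun t => modulus (h (to_Cplx t)) `^ p * W (to_Cplx t))).
- by rewrite mulr_ge0 ?powR_ge0// ltW.
- exact: plane_measurable.
- by move=> t; exact: integrand_ge0.
move=> [s t] [/=]; rewrite !in_itv/= => /andP[s1 s2] /andP[t1 t2].
have zd : modulus (s +i* t - (x +i* y)) < d.
  have -> : s +i* t - (x +i* y) = (s - x)%:C + 'i%C * (t - y)%:C by simpc.
  apply: (@le_lt_trans _ _ (`|s - x| + `|t - y|)).
    rewrite (le_trans (ler_modulusD _ _))// lerD//.
      by rewrite /= expr0n addr0 sqrtr_sqr.
    rewrite ComplexField.Normc.normcM /= !expr0n add0r expr1n sqrtr1 mul1r addr0.
    by rewrite sqrtr_sqr.
  have : `|s - x| <= d / 3 by rewrite ler_distl; apply/andP; lra.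
  have : `|t - y| <= d / 3 by rewrite ler_distl; apply/andP; lra.
  lra.
rewrite ler_pM ?powR_ge0 ?(ltW a0)//.
  by rewrite ge0_ler_powR ?nnegrE ?(ltW p0) ?(ltW c0) ?modulus_ge0 ?hc.
exact: aW (disc_sub (ltW zd)).
Qed.

End fock_approximation.

(** * Quasi-normed spaces of entire functions *)

Section function_space.
Context {R : realType} (F : set (Cplx R -> Cplx R)).
Context (N : (Cplx R -> Cplx R) -> R).
Implicit Types (z w v y : R[i]) (f g h k : Cplx R -> Cplx R) (q : {poly R[i]}).

(* The triangle inequality for [N] only holds up to a constant, through
   [space_dom3]. *)
Record entire_space : Prop := EntireSpace {
  space_norm_ge0 : forall f, 0 <= N f;
  space_entire : forall f, F f -> entire f;
  space_dom3 : forall g f h k (c : R), entire g -> F f -> F h -> F k -> 0 <= c ->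
    (forall z, modulus (g z) <= c * (modulus (f z) + modulus (h z) + modulus (k z))) ->
    F g /\ N g <= 9 * c * (N f + N h + N k);
  space_horner : forall q, F (horner q);
  space_dense : forall f (e : R), F f -> 0 < e ->
    exists q, N (fun z => f z - q.[z]) < e;
  space_lower_bound : forall v (d c : R), 0 < d -> 0 < c ->
    exists2 k : R, 0 < k & forall g, F g ->
      (forall z, modulus (z - v) < d -> c <= modulus (g z)) -> k <= N g;
  space_poly_eval : forall r : R, exists2 C : R, 0 <= C &
    forall q v, modulus v <= r -> modulus q.[v] <= C * N (horner q) }.

Context (HF : entire_space).

Lemma space_dom g f h (c : R) : entire g -> F f -> F h -> 0 <= c ->
  (forall z, modulus (g z) <= c * (modulus (f z) + modulus (h z))) ->
  F g /\ N g <= 9 * c * (N f + N h).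
Proof.
move=> ge ff fh c0 gc; have f0 := space_horner HF 0.
have m0 z : modulus (0 : {poly R[i]}).[z] = 0.
  by rewrite horner0 ComplexField.Normc.normc0.
have e0 : entire (horner (0 : {poly R[i]}) : Cplx R -> Cplx R).
  exact: entire_horner.
(* Domination with [c = 0] yields [N 0 <= 0], so that the zero polynomial can fill the third slot of
   [space_dom3]. *)
have key z : modulus (0 : {poly R[i]}).[z] <= 0 * (modulus (0 : {poly R[i]}).[z] +
    modulus (0 : {poly R[i]}).[z] + modulus (0 : {poly R[i]}).[z]).
  by rewrite m0 mul0r.
have [_] := space_dom3 HF e0 f0 f0 f0 (lexx 0) key.
rewrite mulr0 mul0r => N0.
have [] := space_dom3 HF ge ff fh f0 c0 _.
  by move=> z; rewrite m0 addr0.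
move=> fg Ng; split=> //; apply: le_trans Ng _.
by rewrite ler_wpM2l ?mulr_ge0// -[leRHS]addr0 lerD2l.
Qed.

Lemma space_lin a f g : F f -> F g -> F (fun z => a * f z + g z).
Proof.
move=> ff fg; have c0 : 0 <= modulus a + 1 by rewrite addr_ge0 ?modulus_ge0.
apply: (space_dom _ ff fg c0 _).1.
  by apply: entire_lin; exact: space_entire.
move=> z; rewrite (le_trans (ler_modulusD _ _))// ComplexField.Normc.normcM mulrDr.
by rewrite lerD// ?ler_wpM2r ?lerDl ?ler_peMl ?modulus_ge0// lerDr modulus_ge0.
Qed.

Lemma space_sub f g : F f -> F g -> F (fun z => f z - g z).
Proof.
move=> ff fg; rewrite (_ : (fun z => _) = (fun z => -1 * g z + f z)).
  exact: space_lin.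
by apply/funext => z; rewrite mulN1r addrC.
Qed.

Lemma norm_tri g f h : F g -> F f -> F h ->
  (forall z, modulus (g z) <= modulus (f z) + modulus (h z)) ->
  N g <= 9 * (N f + N h).
Proof.
move=> fg ff fh gz.
have g1 z : modulus (g z) <= 1 * (modulus (f z) + modulus (h z)) by rewrite mul1r.
by have [_] := space_dom (space_entire HF fg) ff fh ler01 g1; rewrite mulr1.
Qed.

(* A polynomial close to [f] in norm is uniformly close on discs: otherwise [f] would
   stay, on a small disc, away from all the better approximating polynomials. *)
Lemma space_approx f (r e : R) : F f -> 0 < e -> exists q,
  N (fun z => f z - q.[z]) <= e /\
  forall z, modulus z <= r -> modulus (f z - q.[z]) <= e.
Proof.
move=> ff e0; have [C C0 CP] := space_poly_eval HF (r + 1).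
(* Two polynomials within [eta] of [f] are at norm distance at most [9 (eta + eta)], hence differ by
   at most [e / 2] on the disc of radius [r + 1]. *)
pose eta := Order.min e (e / (36 * (C + 1))).
have C1 : 0 < 36 * (C + 1) by rewrite mulr_gt0// ltr_wpDl.
have eta0 : 0 < eta by rewrite lt_min e0 divr_gt0.
have etae : (C + 1) * (9 * (eta + eta)) <= e / 2.
  have : eta <= e / (36 * (C + 1)) by rewrite ge_min lexx orbT.
  by rewrite ler_pdivlMr//; lra.
have [q qN] := space_dense HF ff eta0.
have fq := space_sub ff (space_horner HF q).
exists q; split; first by rewrite (le_trans (ltW qN))// ge_min lexx.
move=> v vr; rewrite leNgt; apply/negP => ev.
have [d d0 dP] : exists2 d : R, 0 < d &
    forall z, modulus (z - v) < d -> e <= modulus (f z - q.[z]).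
  have ev0 : 0 < modulus (f v - q.[v]) - e by rewrite subr_gt0.
  have [d d0 dP] := entire_modulusP v (space_entire HF fq) ev0.
  exists d => // z /dP /=.
  by have := ler_modulus_dist (f v - q.[v]) (f z - q.[z]); rewrite modulusB; lra.
have d1 : 0 < Order.min d 1 by rewrite lt_min d0 ltr01.
have [|k k0 kP] := space_lower_bound HF v (c := e / 2) d1.
  by rewrite divr_gt0.
have [|q' q'N] := space_dense HF (e := Order.min eta k) ff.
  by rewrite lt_min eta0 k0.
have fq' := space_sub ff (space_horner HF q').
have fqq : F (horner (q - q')) by exact: (space_horner HF).
move: q'N; rewrite lt_min => /andP[q'N]; rewrite ltNge => /negP; apply.
apply: (kP _ fq') => z; rewrite lt_min => /andP[/dP ez /ltW z1].
have zr : modulus z <= r + 1.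
  by rewrite (le_trans (disc_sub z1))// lerD2r.
have Nqq : N (horner (q - q')) <= 9 * (eta + eta).
  apply: (@le_trans _ _ (9 * (N (fun z => f z - q'.[z]) + N (fun z => f z - q.[z])))).
    apply: (norm_tri fqq fq' fq) => y; rewrite -[modulus (f y - q.[y])]normcN.
    apply: le_trans (ler_modulusD _ _); rewrite hornerD hornerN.
    by rewrite (_ : q.[y] - q'.[y] = f y - q'.[y] - (f y - q.[y])); [|ring].
  by apply: ler_wpM2l; [exact: ler0n|exact: lerD (ltW q'N) (ltW qN)].
have := CP (q - q') z zr; rewrite hornerD hornerN => h.
have h2 : modulus (q.[z] - q'.[z]) <= e / 2.
  apply: le_trans h (le_trans _ etae); apply: ler_pM => //; first exact: (space_norm_ge0 HF).
  by rewrite lerDl.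
have -> : f z - q'.[z] = (f z - q.[z]) - (q'.[z] - q.[z]) by ring.
have := ler_modulus_dist (f z - q.[z]) (q'.[z] - q.[z]).
rewrite [modulus (q'.[z] - _)]modulusB; move: h2 ez.
move: (modulus (q.[z] - q'.[z])) (modulus (f z - q.[z])) (modulus _) => a b c.
by clear; lra.
Qed.

Lemma space_poly_limit f : F f -> poly_limit f.
Proof. by move=> ff r e e0; have [q [_ qP]] := space_approx r ff e0; exists q. Qed.

Lemma space_point_evaluation (r : R) : exists2 C : R, 0 <= C &
  forall f v, F f -> modulus v <= r -> modulus (f v) <= C * N f.
Proof.
have [C C0 CP] := space_poly_eval HF r.
exists (9 * C) => [|f v ff vr]; first by rewrite mulr_ge0.
apply: (@ler_eps_mul _ _ _ (9 * C + 1)) => [|e e0]; first by rewrite addr_ge0 ?mulr_ge0.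
have [q [qN qP]] := space_approx r ff e0.
rewrite -[f v](subrK q.[v]) (le_trans (ler_modulusD _ _))//.
have h1 := qP _ vr; have h2 := CP q v vr.
have : N (horner q) <= 9 * (N f + N (fun z => f z - q.[z])).
  apply: norm_tri; [exact: (space_horner HF)|exact: ff|exact: (space_sub ff (space_horner HF q))|].
  move=> z; rewrite -[modulus (f z - _)]normcN (le_trans _ (ler_modulusD _ _))//.
  by rewrite subKr.
move=> h3; have : C * N (horner q) <= C * (9 * (N f + e)).
  by rewrite ler_wpM2l// (le_trans h3)// ler_wpM2l// lerD2l.
lra.
Qed.

(** Within distance [1] of [w] the Cauchy estimate gives [|R_w f| <= 2 B], where [B = C N f] bounds
    [f] near [w]; farther away [|R_w f| <= |f z| + |f w|]. So [|R_w f|] is dominated by [|f|] plus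
    the constant [2 B]. *)
Lemma space_diffq (r : R) : exists2 A : R, 0 <= A &
  forall w f, modulus w <= r -> F f ->
    F (diffq w f) /\ N (diffq w f) <= A * N f.
Proof.
have [C C0 CP] := space_point_evaluation (r + 1).
pose M := N (horner (1 : {poly R[i]})).
have M0 : 0 <= M by exact: (space_norm_ge0 HF).
(* [324 = 9 * 36]: the constant function [2 B] has norm at most [36 B M], and one more domination
   costs [9]. *)
exists (9 + 324 * C * M) => [|w f wr ff].
  apply: addr_ge0; first exact: ler0n.
  by apply: mulr_ge0 M0; apply: mulr_ge0 C0; exact: ler0n.
have fl := space_poly_limit ff.
set B := C * N f; have B0 : 0 <= B by rewrite mulr_ge0// (space_norm_ge0 HF).
have fB z : modulus z <= r + 1 -> modulus (f z) <= B by exact: CP.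
have cB : modulus ((2 * B)%:C) = 2 * B by rewrite modulus_real// mulr_ge0.
have [_ NB] : F (horner ((2 * B)%:C%:P)) /\ N (horner (2 * B)%:C%:P) <=
    9 * (2 * B) * (M + M).
  have fk := space_horner HF 1.
  apply: (space_dom _ fk fk) => [||z]; [exact: entire_horner|by rewrite mulr_ge0|].
  have -> : (1 : {poly R[i]}).[z] = 1 by rewrite hornerE.
  by rewrite hornerC cB ComplexField.Normc.normc1; lra.
have key z : modulus (diffq w f z) <=
    1 * (modulus (f z) + modulus (horner (2 * B)%:C%:P z)).
  rewrite mul1r hornerC cB.
  have [zw|/ltW zw] := leP (modulus (z - w)) 1.
    rewrite (@le_trans _ _ (2 * B))// ?lerDr ?modulus_ge0//.
    have := @diffq_le _ f w 1 B fl ltr01 _ z zw; rewrite divr1; apply => y yw.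
    by rewrite fB// (le_trans (disc_sub yw))// lerD2r.
  have zw0 : z != w.
    apply: contraTneq zw => ->; rewrite subrr ComplexField.Normc.normc0.
    by rewrite -ltNge ltr01.
  rewrite diffqE// ComplexField.Normc.normcM ComplexField.Normc.normcV.
  rewrite ler_pdivrMr ?(lt_le_trans ltr01)//.
  rewrite (@le_trans _ _ (modulus (f z) + 2 * B))//; last first.
    by apply: ler_peMr => //; apply: addr_ge0; [exact: modulus_ge0|exact: mulr_ge0].
  rewrite (le_trans (ler_modulusD _ _))// normcN lerD2l.
  rewrite (le_trans (fB _ _))//; last by rewrite ler_peMl// ler1n.
  by rewrite (le_trans wr)// lerDl.
have [fd Nd] := space_dom (poly_limit_entire (poly_limit_diffq w fl)) ff
  (space_horner HF _) ler01 key.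
split=> //; apply: le_trans Nd _; move: NB; rewrite /B.
by move: (N f) (N (horner _)) => a b; lra.
Qed.

End function_space.

(** * Growth of functions of finite order *)

Section good_points.
Context {R : realType}.
Implicit Types (z w v y : R[i]) (f g h : Cplx R -> Cplx R) (q : {poly R[i]}).

Lemma exprD1_le (t : R) n : 0 <= t -> t <= 1 -> (1 + t) ^+ n <= 1 + 2 ^+ n * t.
Proof.
move=> t0 t1; suff : (1 + t) ^+ n <= 1 + (2 ^+ n - 1) * t.
  by move=> /le_trans; apply; rewrite lerD2l ler_wpM2r// gerBl.
elim: n => [|n ih]; first by rewrite !expr0 subrr mul0r addr0.
have p1 : 1 <= 2 ^+ n :> R by rewrite exprn_ege1// ler1n.
rewrite !exprSr; set a := (1 + t) ^+ n in ih *; set c := 2 ^+ n in p1 ih *.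
have : a * (1 + t) <= (1 + (c - 1) * t) * (1 + t) by rewrite ler_wpM2r// addr_ge0.
have : (c - 1) * (t * t) <= (c - 1) * t.
  by rewrite ler_wpM2l ?subr_ge0// ler_piMr.
by lra.
Qed.

Lemma sqr_linear_unbounded (a b c : R) : 0 < c ->
  exists j : nat, a + b * j%:R < (c * j%:R) ^+ 2.
Proof.
move=> c0; pose A := `|a| + `|b| + 1.
have A0 : 0 < A by rewrite ltr_wpDl// addr_ge0.
exists (Num.bound (A / c ^+ 2)).+1.
have : A / c ^+ 2 < (Num.bound (A / c ^+ 2))%:R.
  by apply: archi_boundP; rewrite divr_ge0 ?sqr_ge0 ?ltW.
rewrite ltr_pdivrMr ?exprn_gt0//; set k := Num.bound _ => Ak.
have k0 : 0 <= k%:R :> R by exact: ler0n.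
have c2 : 0 < c ^+ 2 by rewrite exprn_gt0.
have : a <= `|a| by exact: ler_norm.
have : b <= `|b| by exact: ler_norm.
have a0 := normr_ge0 a; have b0 := normr_ge0 b.
rewrite exprMn -natr1; set x := k%:R in Ak k0 *; set C := c ^+ 2 in Ak c2 *.
rewrite /A in Ak; move=> bb aa.
have h1 : C * (x + 1) ^+ 2 >= (C * x) * (x + 1) + C * (x + 1).
  by rewrite expr2; nra.
have h2 : C * x * (x + 1) >= (`|a| + `|b| + 1) * (x + 1).
  by rewrite ler_wpM2r ?addr_ge0// ltW// mulrC.
have h3 : 0 <= `|a| * x by rewrite mulr_ge0.
have h4 : b * (x + 1) <= `|b| * (x + 1) by rewrite ler_wpM2r ?addr_ge0.
have h5 : 0 < C * (x + 1) by rewrite mulr_gt0// ltr_wpDl.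
nra.
Qed.

(* Otherwise iterating [w |-> w'] doubles [|f|] at each step while [|w|^m] grows linearly,
   so that [|f|] would outgrow [exp (|w|^rho)] for every [rho <= m / 2]. *)
Lemma good_points f : poly_limit f -> finite_order f ->
  (forall q, f <> horner q) ->
  exists K : nat, forall (n : nat) (r : R), exists w,
    [/\ r <= modulus w, 1 <= modulus w, modulus w ^+ n <= modulus (f w) &
      forall z, modulus (z - w) <= modulus w ^- K ->
        modulus (f z) <= 2 * modulus (f w)].
Proof.
move=> fl [rho [r0 fo]] fnp.
pose k := (Num.bound `|rho|).+1.
have rk : rho <= k%:R.
  rewrite (le_trans (ler_norm _))// (le_trans (ltW (archi_boundP (normr_ge0 _))))//.
  by rewrite ler_nat.
(* With [K = m - 1], a move of length at most [|w|^-K] increases [|w|^m] by at most [2^m]. After [j]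
   doublings [|w|^(2 k)] is at most linear in [j], whereas finite order with [rho <= k] forces
   [j ln 2 <= |w|^k]. *)
pose m := (k + k)%N; exists m.-1 => n r; apply: contrapT => bad.
(* [2^n <= |w|] ensures [(1 + 1 / |w|)^n <= 2], so that the lower bound [|w|^n] of [|f w|] at most
   doubles in a step, as [|f w|] at least does. *)
pose r1 := Order.max (Order.max r r0) (2 ^+ n : R).
have r11 : 1 <= r1 by rewrite /r1 le_max exprn_ege1 ?orbT// ler1n.
have [B B0 fB] := poly_limit_disc_bounded r1 fl.
(* [B] bounds [|f|] on the disc of radius [r1]: as [|f|] increases, the condition [B < |f w|] keeps
   the iterates out of that disc. A starting point exists by Liouville's theorem. *)
pose P w := [/\ r1 <= modulus w, modulus w ^+ n <= modulus (f w) & B < modulus (f w)].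
have [w0 Pw0] : exists w, P w.
  apply: contrapT => nP; have [q] : exists q, f = horner q; last exact: fnp.
  apply: (@liouville_poly _ f n (1 + B) r1 fl) => z rz.
  have z1 : 1 <= modulus z ^+ n by rewrite exprn_ege1// (le_trans r11).
  rewrite leNgt; apply/negP => fz; apply: nP; exists z; split => //.
    by apply: le_trans (ltW fz); rewrite ler_peMl ?lerDl// exprn_ge0// modulus_ge0.
  by apply: le_lt_trans fz; rewrite (@le_trans _ _ (1 + B)) ?lerDr// ler_peMr ?addr_ge0.
have step w : P w -> exists w', [/\ P w', 2 * modulus (f w) <= modulus (f w') &
    modulus w' <= modulus w + modulus w ^- m.-1].
  move=> [w1 w2 w3].
  have w11 : 1 <= modulus w by exact: le_trans w1.
  have [w' [d1 d2]] : exists w', modulus (w' - w) <= modulus w ^- m.-1 /\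
      2 * modulus (f w) < modulus (f w').
    apply: contrapT => nw'; apply: bad; exists w; split => //.
      by apply: le_trans w1; rewrite /r1 !le_max lexx.
    move=> z zw; rewrite leNgt; apply/negP => fz; apply: nw'.
    by exists z.
  have d3 := disc_sub d1.
  have wp : 0 < modulus w by exact: lt_le_trans w11.
  exists w'; split => //; last exact: ltW.
  have fw : modulus (f w) <= 2 * modulus (f w).
    by rewrite mulr_natl mulr2n lerDl modulus_ge0.
  have Bw : B < modulus (f w') by rewrite (lt_le_trans w3)// (le_trans fw)// ltW.
  split => //.
    by rewrite leNgt; apply/negP => /ltW/fB; rewrite leNgt Bw.
  apply: le_trans (ltW d2); apply: le_trans (_ : 2 * modulus w ^+ n <= _); last first.
    by rewrite ler_wpM2l.
  apply: le_trans (_ : (modulus w * (1 + (modulus w)^-1)) ^+ n <= _).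
    rewrite lerXn2r ?nnegrE ?modulus_ge0 ?mulr_ge0 ?addr_ge0 ?invr_ge0 ?modulus_ge0//.
    rewrite (le_trans d3)// mulrDr mulr1 divff ?gt_eqF// lerD2l.
    by rewrite invf_le1 ?exprn_gt0// exprn_ege1.
  rewrite exprMn mulrC ler_wpM2r ?exprn_ge0 ?modulus_ge0//.
  rewrite (le_trans (exprD1_le _ _ _)) ?invr_ge0 ?modulus_ge0 ?invf_le1//.
  have : 2 ^+ n / modulus w <= 1.
    by rewrite ler_pdivrMr// mul1r (le_trans _ w1)// /r1 le_max lexx orbT.
  by lra.
have iter j : exists w, [/\ P w, 2 ^+ j <= modulus (f w) &
    modulus w ^+ m <= modulus w0 ^+ m + 2 ^+ m * j%:R].
  elim: j => [|j [w [Pw fw wm]]].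
    exists w0; split => //; last by rewrite mulr0 addr0.
    case: Pw0 => h1 h2 _; rewrite expr0 (le_trans _ h2)// exprn_ege1//.
    exact: le_trans h1.
  have [w' [Pw' fw' ww']] := step w Pw; exists w'; split => //.
    by rewrite exprS (le_trans _ fw')// ler_wpM2l.
  have w11 : 1 <= modulus w by case: Pw => h _ _; exact: le_trans h.
  have w0' : 0 < modulus w by exact: lt_le_trans w11.
  have wm0 : 0 < modulus w ^+ m by rewrite exprn_gt0.
  have e : modulus w + modulus w ^- m.-1 = modulus w * (1 + modulus w ^- m).
    have mE : m = m.-1.+1 by [].
    rewrite mulrDr mulr1 [in RHS]mE exprS invfM mulrA divff ?gt_eqF// mul1r//.
  apply: (@le_trans _ _ ((modulus w * (1 + modulus w ^- m)) ^+ m)).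
    by rewrite lerXn2r ?nnegrE ?modulus_ge0 -?e ?addr_ge0 ?invr_ge0 ?exprn_ge0 ?modulus_ge0.
  rewrite exprMn -[j.+1%:R]natr1 [_ * (j%:R + 1)]mulrDr mulr1 addrA.
  apply: (@le_trans _ _ (modulus w ^+ m * (1 + 2 ^+ m * modulus w ^- m))).
    rewrite ler_wpM2l ?(ltW wm0)// exprD1_le ?invr_ge0 ?(ltW wm0)//.
    by rewrite invf_le1// exprn_ege1.
  by rewrite mulrDr mulr1 mulrCA divff ?gt_eqF// mulr1 lerD2r.
have [j jP] := @sqr_linear_unbounded (modulus w0 ^+ m) (2 ^+ m) (ln 2) (ln_gt0 (ltr1n R 2)).
have [w [[w1 _ _] fw wm]] := iter j.
have w11 : 1 <= modulus w by exact: le_trans w1.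
have : ln 2 * j%:R <= modulus w ^+ k.
  rewrite -ler_expR expRM_natr lnK ?posrE//.
  apply: le_trans fw _; apply: le_trans (fo _ _) _.
    by apply: le_trans w1; rewrite /r1 !le_max lexx orbT.
  by rewrite ler_expR -powR_mulrn ?modulus_ge0// ler_powR.
move=> lk; move: jP; rewrite ltNge => /negP; apply.
apply: le_trans wm; rewrite /m exprD -expr2 lerXn2r ?nnegrE ?exprn_ge0 ?modulus_ge0//.
by rewrite mulr_ge0// ln_ge0// ler1n.
Qed.

End good_points.

(** * Invariant subspaces *)

Section invariant_subspaces.
Context {R : realType} (F : set (Cplx R -> Cplx R)).
Context (N : (Cplx R -> Cplx R) -> R) (HF : entire_space F N).
Context (M : set (Cplx R -> Cplx R)).
Context (MF : M `<=` F) (M0 : M (fun=> 0)).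
Context (Mlin : forall (a : R[i]) f g, M f -> M g -> M (fun z => a * f z + g z)).
Context (Mcl : forall f, F f ->
  (forall e : R, 0 < e -> exists2 g, M g & N (fun z => f z - g z) < e) -> M f).
Context (ML : forall f, M f -> M (diffq 0 f)).
Implicit Types (z w v y : R[i]) (f g h : Cplx R -> Cplx R) (q : {poly R[i]}).

Lemma iter_diffq_space v f j : F f -> F (iter j (diffq v) f).
Proof.
move=> ff; elim: j => //= j ih.
by have [A _ AP] := space_diffq HF (modulus v); have [] := AP v _ (lexx _) ih.
Qed.

(** [R_v^j] applied to [R_w = (w - v) R_v R_w + R_v]; it moves the remainder of the Neumann series
    one step further. *)
Lemma iter_diffq_resolvent v w f j : F f ->
  iter j (diffq v) (diffq w f) =
  (fun z => (w - v) * iter j.+1 (diffq v) (diffq w f) z + iter j.+1 (diffq v) f z).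
Proof.
move=> ff; have fl := space_poly_limit HF ff.
have Fw : F (diffq w f).
  by have [A _ AP] := space_diffq HF (modulus w); have [] := AP w _ (lexx _) ff.
elim: j => [|j ih]; first exact: diffq_resolvent.
rewrite iterS [in LHS]ih diffq_lin//.
- exact/(space_poly_limit HF)/iter_diffq_space.
- exact/(space_poly_limit HF)/iter_diffq_space.
Qed.

(* The Neumann series [sum_j (w - v)^j R_v^(j+1)] of [R_w = diffq w] has partial sums
   in [M]. *)
Lemma diffq_subspace_near (r A : R) v w :
  (forall u f, modulus u <= r -> F f -> F (diffq u f) /\ N (diffq u f) <= A * N f) ->
  0 <= A -> modulus v <= r -> modulus w <= r -> modulus (w - v) * A <= 2^-1 ->
  (forall f, M f -> M (diffq v f)) -> forall f, M f -> M (diffq w f).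
Proof.
move=> AP A0 vr wr wvA Mv f Mf; have ff := MF Mf.
have [Fg _] := AP w f wr ff; set g := diffq w f in Fg *.
have Miter j : M (iter j.+1 (diffq v) f).
  by elim: j => [|j ih]; [exact: Mv|exact: Mv].
(* The remainder after [j] terms is exactly [(w - v)^j R_v^j R_w f], so convergence only needs a
   norm bound on it. *)
have psum j : exists2 s, M s &
    forall z, g z - s z = (w - v) ^+ j * iter j (diffq v) g z.
  elim: j => [|j [s Ms sE]].
    by exists (fun=> 0) => // z; rewrite expr0 mul1r subr0.
  exists (fun z => (w - v) ^+ j * iter j.+1 (diffq v) f z + s z).
    exact: Mlin.
  move=> z; rewrite opprD addrCA sE [in X in _ + X](iter_diffq_resolvent v w j ff).
  by rewrite exprSr; ring.
have Niter j : N (iter j (diffq v) g) <= A ^+ j * N g.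
  elim: j => [|j ih]; first by rewrite expr0 mul1r.
  have [_ /= h] := AP v _ vr (iter_diffq_space v j Fg).
  by rewrite (le_trans h)// exprS -mulrA ler_wpM2l.
apply: Mcl => // e e0.
have Ng0 : 0 <= N g by exact: (space_norm_ge0 HF).
have [j je] : exists j : nat, 18 * N g < e * 2 ^+ j.
  exists (Num.bound (18 * N g / e)); rewrite [e * _]mulrC -ltr_pdivrMr//.
  have h : 0 <= 18 * N g / e by rewrite divr_ge0 ?mulr_ge0 ?ler0n ?(ltW e0).
  apply: lt_trans (archi_boundP h) _.
  by rewrite -natrX ltr_nat ltn_expl.
have [s Ms sE] := psum j; exists s => //.
have Fh := iter_diffq_space v j Fg.
have dom z : modulus (g z - s z) <= modulus (w - v) ^+ j *
    (modulus (iter j (diffq v) g z) + modulus (iter j (diffq v) g z)).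
  rewrite sE ComplexField.Normc.normcM modulusX ler_wpM2l ?exprn_ge0 ?modulus_ge0//.
  by rewrite lerDl modulus_ge0.
have Fs := space_sub HF Fg (MF Ms).
have c0 : 0 <= modulus (w - v) ^+ j by rewrite exprn_ge0 ?modulus_ge0.
have [_ Ns] := space_dom HF (space_entire HF Fs) Fh Fh c0 dom.
apply: le_lt_trans Ns _.
apply: (@le_lt_trans _ _ (18 * ((modulus (w - v) * A) ^+ j * N g))).
  rewrite exprMn -[X in _ <= 18 * X]mulrA.
  have := ler_wpM2l c0 (Niter j); move: (N (iter j _ g)) (A ^+ j * N g) => a b.
  by move: (_ ^+ j) => c; lra.
apply: (@le_lt_trans _ _ (18 * (2^-1 ^+ j * N g))).
  rewrite ler_wpM2l ?ler0n// ler_wpM2r// lerXn2r// nnegrE ?invr_ge0//.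
  by rewrite mulr_ge0// modulus_ge0.
by rewrite mulrCA exprVn mulrC ltr_pdivrMr ?exprn_gt0.
Qed.

Lemma diffq_subspace w f : M f -> M (diffq w f).
Proof.
have [A A0 AP] := space_diffq HF (modulus w).
have [n n0 nP] : exists2 n : nat, (0 < n)%N & modulus w / n%:R * A <= 2^-1.
  exists (Num.bound (2 * modulus w * A)).+1 => //.
  have h : 0 <= 2 * modulus w * A by rewrite !mulr_ge0 ?modulus_ge0.
  rewrite mulrAC ler_pdivrMr//; have := archi_boundP h.
  set b := Num.bound _; have -> : b.+1%:R = b%:R + 1 :> R by rewrite natr1.
  by lra.
have n0R : 0 < n%:R :> R by rewrite ltr0n.
pose u k := (k%:R / n%:R)%:C * w.
have ur k : (k <= n)%N -> modulus (u k) <= modulus w.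
  move=> kn; rewrite ComplexField.Normc.normcM modulus_real ?divr_ge0//.
  by rewrite ler_piMl ?modulus_ge0// ler_pdivrMr// mul1r ler_nat.
have Mu k : (k <= n)%N -> forall g, M g -> M (diffq (u k) g).
  elim: k => [_ g Mg|k ih kn]; first by rewrite /u mul0r mul0r; exact: ML.
  apply: (diffq_subspace_near AP A0 (ur _ (ltnW kn)) (ur _ kn)); last first.
    exact: ih (ltnW kn).
  rewrite /u -mulrBl -rmorphB/= -mulrBl -natr1 addrAC subrr add0r.
  rewrite ComplexField.Normc.normcM modulus_real ?divr_ge0// mul1r.
  by rewrite [_^-1 * _]mulrC.
by have := Mu n (leqnn n) f; rewrite /u divff ?mul1r// gt_eqF.
Qed.

Lemma subspace_sub f g : M f -> M g -> M (fun z => f z - g z).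
Proof.
move=> Mf Mg; rewrite (_ : (fun z => _) = (fun z => -1 * g z + f z)).
  exact: Mlin.
by apply/funext => z; rewrite mulN1r addrC.
Qed.

Lemma subspace_horner q :
  (forall j, (j < size q)%N -> M (horner 'X^j)) -> M (horner q).
Proof.
move=> Mj; rewrite (_ : horner q = fun z => \sum_(i < size q) q`_i * z ^+ i); last first.
  by apply/funext => z; rewrite horner_coef.
have : forall n, (n <= size q)%N -> M (fun z => \sum_(i < n) q`_i * z ^+ i).
  elim=> [_|n ih nq].
    by rewrite (_ : (fun _ => _) = fun=> 0)//; apply/funext => z; rewrite big_ord0.
  rewrite (_ : (fun _ => _) =
      (fun z => q`_n * 'X^n.[z] + \sum_(i < n) q`_i * z ^+ i)).
    by apply: Mlin; [exact: Mj|exact: ih (ltnW nq)].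
  by apply/funext => z; rewrite big_ord_recr/= hornerXn addrC.
by apply.
Qed.

Lemma subspace_all : (forall j, M (horner 'X^j)) -> M = F.
Proof.
move=> Mj; apply/seteqP; split => // f ff; apply: Mcl => // e e0.
have [q qe] := space_dense HF ff e0.
by exists (horner q) => //; apply: subspace_horner => j _.
Qed.

(** [diffq 0] drops the constant term and shifts the others down, so induction on the size gives
    every monomial below the leading one; subtracting the lower terms of [q] and dividing by its
    leading coefficient gives that one too. *)
Lemma subspace_poly_lower q : M (horner q) ->
  forall j, (j < size q)%N -> M (horner 'X^j).
Proof.
have [n] := ubnP (size q); elim: n q => // n ih q qn Mq.
have [->|q0] := eqVneq q 0; first by rewrite size_poly0.
have tE z : (take_poly 1 q).[z] = q.[0].
  have -> : q.[0] = (take_poly 1 q).[0].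
    by rewrite -[in LHS](poly_take_drop 1 q) hornerD hornerM hornerXn expr1 mulr0 addr0.
  by have /size1_polyC -> := size_take_poly 1 q; rewrite !hornerC.
have pq : diffq 0 (horner q) = horner (drop_poly 1 q).
  apply/esym/diffq_unique; [exact: poly_limit_horner|exact: poly_limit_horner|].
  move=> z; rewrite -{2}[q](poly_take_drop 1 q) hornerD hornerM hornerXn expr1 tE.
  by rewrite subr0 [q.[0] + _]addrC addrK.
have sq : (0 < size q)%N by rewrite size_poly_gt0.
have lower j : (j < (size q).-1)%N -> M (horner 'X^j).
  move=> jq; apply: (ih (drop_poly 1 q)); rewrite ?size_drop_poly ?subn1//.
    by rewrite -ltnS prednK.
  by rewrite -pq; exact: ML.
move=> j; rewrite -{1}(prednK sq) ltnS leq_eqVlt => /predU1P[->|]; last exact: lower.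
have Mt : M (horner (take_poly (size q).-1 q)).
  apply: subspace_horner => i it; apply: lower.
  by rewrite (leq_trans it)// size_take_poly.
rewrite (_ : horner 'X^_ = fun z =>
    (lead_coef q)^-1 * (q.[z] - (take_poly (size q).-1 q).[z]) + 0).
  by apply: Mlin => //; exact: subspace_sub.
apply/funext => z; rewrite addr0 [q.[z]](_ : _ = (take_poly (size q).-1 q).[z] +
    (drop_poly (size q).-1 q).[z] * ('X^((size q).-1)).[z]); last first.
  by rewrite -hornerM -hornerD poly_take_drop.
rewrite addrC addrA addNr add0r.
have /size1_polyC -> : (size (drop_poly (size q).-1 q) <= 1)%N.
  by rewrite size_drop_poly -{1}(prednK sq) subSnn.
by rewrite coef_drop_poly add0n hornerC mulrA mulVf ?mul1r// lead_coef_eq0.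
Qed.

(** If the degrees in [M] are unbounded, [M] contains all monomials; otherwise the largest size that
    occurs, positive because [M] is not zero, determines [n]. *)
Lemma subspace_polys : (forall f, M f -> exists q, f = horner q) ->
  M <> [set (fun=> 0)] -> M = F \/ exists n, M = @polynomials_le R n.
Proof.
move=> Mpoly Mnz.
have [unb|bnd] := pselect (forall n, exists2 q, M (horner q) & (n < size q)%N).
  left; apply: subspace_all => j; have [q Mq jq] := unb j.
  exact: (subspace_poly_lower Mq).
right; have {bnd}[b bP] : exists b, forall q, M (horner q) -> (size q <= b)%N.
  apply: contrapT => nb; apply: bnd => n; apply: contrapT => nq; apply: nb.
  by exists n => q Mq; rewrite leqNgt; apply/negP => nsq; apply: nq; exists q.
pose P s := `[< exists2 q, M (horner q) & size q = s >].
have Pb s : P s -> (s <= b)%N by move=> /asboolP[q /bP + <-].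
have Pex : exists s, P s.
  exists 0%N; apply/asboolP; exists 0; last by rewrite size_poly0.
  by rewrite (_ : horner _ = fun=> 0)//; apply/funext => z; rewrite horner0.
case: (ex_maxnP Pex Pb) => s /asboolP[q Mq qs] smax.
have s0 : (0 < s)%N.
  rewrite lt0n; apply/eqP => s0; apply: Mnz; apply/seteqP; split => f /=; last first.
    by move=> ->.
  move=> Mf; have [r fE] := Mpoly _ Mf; rewrite fE in Mf *.
  have : (size r <= s)%N by apply: smax; apply/asboolP; exists r.
  by rewrite s0 leqn0 size_poly_eq0 => /eqP ->; apply/funext => z; rewrite horner0.
exists s.-1; apply/seteqP; split => f.
  move=> Mf; have [r fE] := Mpoly _ Mf; exists r => //; rewrite prednK//.
  by apply: smax; apply/asboolP; exists r => //; rewrite -fE.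
move=> [r rs ->]; apply: subspace_horner => j jr.
apply: (subspace_poly_lower Mq); rewrite qs (leq_trans jr)// (leq_trans rs)//.
by rewrite prednK.
Qed.

End invariant_subspaces.

(** * Approximating monomials by means of a function that is not a polynomial *)

Section nonpolynomial_element.
Context {R : realType}.
Implicit Types (z w v y : R[i]) (f g h : Cplx R -> Cplx R) (q : {poly R[i]}).

Lemma exprn_le_add1 (x : R) n m : 0 <= x -> (n <= m)%N -> x ^+ n <= 1 + x ^+ m.
Proof.
move=> x0 nm; have [x1|x1] := leP x 1.
  by rewrite (@le_trans _ _ 1) ?exprn_ile1// lerDl exprn_ge0.
by rewrite (@le_trans _ _ (x ^+ m)) ?lerDr// ler_weXn2l// ltW.
Qed.

(** Used with [a = |w|^(n + 1)], [b = |w|^K], [c = |w|], [s = |f z|], [t = |f w|] and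
    [d = 1 / |z - w|]. *)
Lemma far_quotient_le (a b c s t d : R) : 0 < c -> 0 <= s -> 0 < t ->
  0 <= a -> 0 <= d -> d <= b -> a * b * c <= t -> a * (s / t) * d <= s / c.
Proof.
move=> c0 s0 t0 a0 d0 db abc; rewrite ler_pdivlMr//.
have -> : a * (s / t) * d * c = s / t * (a * d * c) by ring.
have tn0 : t != 0 by rewrite gt_eqF.
rewrite -[leRHS](divfK tn0) ler_wpM2l ?divr_ge0 ?(ltW t0)//.
by apply: le_trans abc; rewrite ler_wpM2r ?(ltW c0)// ler_wpM2l.
Qed.

(** Here [x = |z|], [c = |w|] and [d = 1 / |z - w|]. If [2 |z| <= |w|], then [|z - w| >= |w| / 2]
    and [d] itself decays; otherwise the factor [|w|^(K + 1)] is absorbed by [(2 |z|)^(K + 1)]. *)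
Lemma far_power_le (x c d : R) n K : 0 <= x -> 0 < c -> 0 <= d -> d <= c ^+ K ->
  c - x <= d^-1 -> 0 < d ->
  x ^+ n.+1 * d <= (2 + 2 ^+ K.+1) / c * (1 + x ^+ (n + K).+2).
Proof.
move=> x0 c0 d0 dc cx d1.
have xn0 : 0 <= x ^+ n.+1 by rewrite exprn_ge0.
have xm0 : 0 <= x ^+ (n + K).+2 by rewrite exprn_ge0.
have k0 : 0 <= 2 ^+ K.+1 :> R by rewrite exprn_ge0.
rewrite mulrAC ler_pdivlMr//; have [xs|xb] := leP (2 * x) c.
  have dc2 : d * c <= 2.
    have : d * (c - x) <= 1 by rewrite -ler_pdivlMl// mulr1.
    have : d * (2 * x) <= d * c by rewrite ler_wpM2l.
    lra.
  have xn : x ^+ n.+1 <= 1 + x ^+ (n + K).+2.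
    by apply: exprn_le_add1 => //; rewrite ltnS ltnW// ltnS leq_addr.
  rewrite -mulrA (@le_trans _ _ (x ^+ n.+1 * 2)) ?ler_wpM2l//.
  have : 0 <= 2 ^+ K.+1 * (1 + x ^+ (n + K).+2) by rewrite mulr_ge0// addr_ge0.
  by move: xn; move: (x ^+ n.+1) (x ^+ (n + K).+2) => a b; lra.
have h : x ^+ n.+1 * d * c <= 2 ^+ K.+1 * x ^+ (n + K).+2.
  have -> : 2 ^+ K.+1 * x ^+ (n + K).+2 = x ^+ n.+1 * (2 * x) ^+ K.+1.
    by rewrite exprMn [RHS]mulrCA -exprD addSn addnS.
  rewrite -mulrA ler_wpM2l// exprSr (@le_trans _ _ (c ^+ K * c))//.
    by rewrite ler_wpM2r// ltW.
  rewrite ler_pM ?exprn_ge0 ?(ltW c0) ?(ltW xb)//.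
  by rewrite lerXn2r ?nnegrE ?(ltW c0) ?mulr_ge0 ?(ltW xb).
apply: le_trans h _.
by move: k0 xm0; move: (2 ^+ K.+1) (x ^+ (n + K).+2) => a b; nra.
Qed.

(** This is [z^n] minus its approximation [w^n (w R_w f / f w - sum_(j < n) (z / w)^j)]; the term
    [j = n] of the sum is [z^n] itself. *)
Definition monomial_error f w n : Cplx R -> Cplx R := fun z =>
  (\sum_(j < n.+1) w ^+ (n - j) * z ^+ j) - w ^+ n.+1 / f w * diffq w f z.

(** The geometric sum contributes [z^(n + 1) - w^(n + 1)], whose second term cancels against the one
    coming from [f w / f w]. What remains of [w^(n + 1)] is divided by the large value [f w]. *)
Lemma monomial_errorM f w n z : f w != 0 ->
  monomial_error f w n z * (z - w) = z ^+ n.+1 - w ^+ n.+1 * (f z / f w).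
Proof.
move=> fw; rewrite /monomial_error mulrBl -[_ * diffq _ _ _ * _]mulrA diffqM.
have -> : (\sum_(j < n.+1) w ^+ (n - j) * z ^+ j) * (z - w) = z ^+ n.+1 - w ^+ n.+1.
  by rewrite -opprB mulrN mulrC -subrXX opprB.
by field.
Qed.

(** The first summand serves near [w], with [2^(n + K + 2)] accounting for [|w| <= 2 |z|]; the
    others come from [far_power_le]. *)
Definition error_constant n K : R :=
  (4 + n.+1%:R * 2 ^+ n) * 2 ^+ (n + K).+2 + 2 ^+ K.+1 + 2.

Lemma error_constant_ge0 n K : 0 <= error_constant n K.
Proof.
have e0 m : 0 <= 2 ^+ m :> R by rewrite exprn_ge0.
by apply: addr_ge0 => //; apply: addr_ge0 => //; rewrite mulr_ge0// addr_ge0// mulr_ge0.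
Qed.

(** The exponent is [(n + 1) + K + 1]: [|f w|] has to absorb [|w|^(n + 1)] and
    [1 / |z - w| <= |w|^K], and still leave [1 / |w|]. *)
Lemma monomial_error_far f w n K z : f w != 0 -> 1 <= modulus w ->
  modulus w ^+ (n + K).+2 <= modulus (f w) ->
  modulus w ^- K <= modulus (z - w) ->
  modulus (monomial_error f w n z) <= (error_constant n K / modulus w) *
    (modulus (f z) + 1 + modulus z ^+ (n + K).+2).
Proof.
move=> fw w1 fwK zw.
have w0 : 0 < modulus w by exact: lt_le_trans w1.
have wK0 : 0 < modulus w ^+ K by rewrite exprn_gt0.
have d0 : 0 < modulus (z - w) by apply: lt_le_trans zw; rewrite invr_gt0.
have zw0 : z - w != 0 by rewrite -modulus_gt0.
have fw0 : 0 < modulus (f w) by rewrite modulus_gt0.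
have m0 : 0 <= modulus z by exact: modulus_ge0.
have f0 : 0 <= modulus (f z) by exact: modulus_ge0.
have C2 : 2 + 2 ^+ K.+1 + 1 <= error_constant n K.
  have : 1 <= (4 + n.+1%:R * 2 ^+ n) * 2 ^+ (n + K).+2 :> R.
    rewrite mulr_ege1 ?exprn_ege1 ?ler1n//.
    by rewrite (@le_trans _ _ 4) ?ler1n// lerDl mulr_ge0 ?exprn_ge0.
  by rewrite /error_constant; set a := _ * 2 ^+ (n + K).+2; lra.
have zwi : (modulus (z - w))^-1 <= modulus w ^+ K.
  by rewrite -[leRHS]invrK lef_pV2 ?posrE ?invr_gt0.
have d1 : 0 < (modulus (z - w))^-1 by rewrite invr_gt0.
have -> : monomial_error f w n z =
    z ^+ n.+1 / (z - w) - w ^+ n.+1 * (f z / f w) / (z - w).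
  by rewrite -mulrBl -monomial_errorM// mulfK.
rewrite (le_trans (ler_modulusD _ _))// normcN.
rewrite !ComplexField.Normc.normcM !ComplexField.Normc.normcV !modulusX.
have t1 := @far_power_le (modulus z) (modulus w) (modulus (z - w))^-1 n K m0 w0
  (ltW d1) zwi.
have {}t1 := t1 _ d1; rewrite invrK in t1.
have cz : modulus w - modulus z <= modulus (z - w).
  by rewrite modulusB ler_modulus_dist.
have {}t1 := t1 cz.
have t2 : modulus w ^+ n.+1 * (modulus (f z) / modulus (f w)) / modulus (z - w) <=
    modulus (f z) / modulus w.
  apply: (far_quotient_le w0 f0 fw0 _ (ltW d1) zwi); first by rewrite exprn_ge0 ?modulus_ge0.
  by rewrite -exprD -exprSr addSn.
apply: le_trans (lerD t1 t2) _.
have zm0 : 0 <= modulus z ^+ (n + K).+2 by rewrite exprn_ge0.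
have u0 : 0 <= (modulus w)^-1 by rewrite invr_ge0 ltW.
have A0 : 0 <= 2 + 2 ^+ K.+1 :> R by rewrite addr_ge0 ?exprn_ge0.
move: C2 zm0 u0 A0 f0; move: (error_constant n K) (modulus z ^+ (n + K).+2) => c s.
move: (2 + 2 ^+ K.+1) (modulus w)^-1 (modulus (f z)) => a u b ac s0 u0 a0 b0.
have h1 : a * u * (1 + s) <= c * u * (1 + s).
  by rewrite ler_wpM2r ?addr_ge0// ler_wpM2r//; lra.
have h2 : 1 * (u * b) <= c * (u * b) by rewrite ler_wpM2r ?mulr_ge0//; lra.
lra.
Qed.

Lemma monomial_error_near f w n K z : poly_limit f -> f w != 0 -> 2 <= modulus w ->
  (forall y, modulus (y - w) <= modulus w ^- K -> modulus (f y) <= 2 * modulus (f w)) ->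
  modulus (z - w) <= modulus w ^- K ->
  modulus (monomial_error f w n z) <= (error_constant n K / modulus w) *
    (modulus (f z) + 1 + modulus z ^+ (n + K).+2).
Proof.
move=> fl fw w2 f2 zw.
have w1 : 1 <= modulus w by lra.
have w0 : 0 < modulus w by lra.
have d0 : 0 < modulus w ^- K by rewrite invr_gt0 exprn_gt0.
have d1 : modulus w ^- K <= 1 by rewrite invf_le1 ?exprn_gt0// exprn_ege1.
have m0 : 0 <= modulus z by exact: modulus_ge0.
have zw2 : modulus z <= 2 * modulus w by have := disc_sub zw; lra.
have wz2 : modulus w <= 2 * modulus z.
  by have := ler_modulus_dist w z; rewrite [modulus (w - z)]modulusB; lra.
have q1 := diffq_le fl d0 f2 zw; rewrite invrK in q1.
set x := modulus w in w2 w1 w0 zw2 wz2 q1 zw d0 d1 f2 *.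
have t1 : modulus (w ^+ n.+1 / f w * diffq w f z) <= 4 * x ^+ (n + K).+1.
  rewrite !ComplexField.Normc.normcM ComplexField.Normc.normcV modulusX -/x.
  have fw0 : 0 < modulus (f w) by rewrite modulus_gt0.
  rewrite mulrAC ler_pdivrMr// (le_trans (ler_wpM2l _ q1)) ?exprn_ge0 ?(ltW w0)//.
  rewrite le_eqVlt; apply/orP; left; apply/eqP.
  by rewrite -addSn exprD; ring.
have t2 : modulus (\sum_(j < n.+1) w ^+ (n - j) * z ^+ j) <=
    n.+1%:R * 2 ^+ n * x ^+ (n + K).+1.
  rewrite (le_trans (ler_modulus_sum _ _ _))// -mulrA mulr_natl -[n.+1 in leRHS]card_ord.
  rewrite -sumr_const ler_sum// => j _.
  rewrite ComplexField.Normc.normcM !modulusX -/x.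
  have jn : (j <= n)%N by rewrite -ltnS.
  apply: (@le_trans _ _ (x ^+ (n - j) * (2 * x) ^+ j)).
    by rewrite ler_wpM2l ?exprn_ge0 ?(ltW w0)// lerXn2r ?nnegrE ?mulr_ge0 ?(ltW w0).
  rewrite exprMn [leLHS]mulrCA -exprD subnK// ler_pM ?exprn_ge0 ?(ltW w0)//.
    by rewrite ler_weXn2l ?ler1n.
  by rewrite ler_weXn2l// ltnW// ltnS leq_addr.
have C1 : (4 + n.+1%:R * 2 ^+ n) * 2 ^+ (n + K).+2 <= error_constant n K.
  have : 0 <= 2 ^+ K.+1 :> R by rewrite exprn_ge0.
  by rewrite /error_constant; set a := _ * 2 ^+ (n + K).+2; lra.
rewrite (le_trans (ler_modulusD _ _))// normcN (le_trans (lerD t2 t1))//.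
rewrite -mulrDl [_ + 4]addrC mulrAC ler_pdivlMr// -mulrA -exprSr.
have c0 : 0 <= 4 + n.+1%:R * 2 ^+ n :> R by rewrite addr_ge0 ?mulr_ge0 ?exprn_ge0.
have h : (4 + n.+1%:R * 2 ^+ n) * x ^+ (n + K).+2 <=
    error_constant n K * modulus z ^+ (n + K).+2.
  apply: (@le_trans _ _ ((4 + n.+1%:R * 2 ^+ n) * (2 * modulus z) ^+ (n + K).+2)).
    by rewrite ler_wpM2l// lerXn2r ?nnegrE ?mulr_ge0 ?(ltW w0).
  by rewrite exprMn mulrA ler_wpM2r ?exprn_ge0.
apply: le_trans h _; by rewrite ler_wpM2l ?lerDr ?addr_ge0 ?modulus_ge0.
Qed.

End nonpolynomial_element.

Section monomials.
Context {R : realType} (F : set (Cplx R -> Cplx R)).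
Context (N : (Cplx R -> Cplx R) -> R) (HF : entire_space F N).
Context (M : set (Cplx R -> Cplx R)).
Context (MF : M `<=` F) (M0 : M (fun=> 0)).
Context (Mlin : forall (a : R[i]) f g, M f -> M g -> M (fun z => a * f z + g z)).
Context (Mcl : forall f, F f ->
  (forall e : R, 0 < e -> exists2 g, M g & N (fun z => f z - g z) < e) -> M f).
Context (ML : forall f, M f -> M (diffq 0 f)).
Implicit Types (z w v y : R[i]) (f g h : Cplx R -> Cplx R) (q : {poly R[i]}).

(* As [w] runs through points where [f] is large, [w R_w f / f w] tends to [1], its
   difference with [1], multiplied by [w], tends to ['X], and so on. *)
Lemma subspace_monomials f : M f -> finite_order f ->
  (forall q, f <> horner q) -> forall n, M (horner 'X^n).
Proof.
move=> Mf fo fnp; have fl := space_poly_limit HF (MF Mf).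
have [K KP] := good_points fl fo fnp.
elim/ltn_ind => n ih; have FX := space_horner HF 'X^n.
apply: Mcl FX _ => e e0.
pose T := N f + N (horner 1) + N (horner 'X^((n + K).+2)).
have T0 : 0 <= T by rewrite !addr_ge0// (space_norm_ge0 HF).
have C0 : 0 <= error_constant n K :> R by exact: error_constant_ge0.
(* [r <= |w|] makes the final bound [9 (error_constant n K / |w|) T] smaller than [e]; the summand
   [2] provides [|w| >= 2] for the estimate near [w]. *)
pose r : R := 2 + 9 * error_constant n K * T / e.
have r2 : 0 <= 9 * error_constant n K * T / e.
  by rewrite divr_ge0 ?(ltW e0)// mulr_ge0// mulr_ge0.
have [w [wr w1 fwn fw2]] := KP (n + K).+2 r.
have w2 : 2 <= modulus w by apply: le_trans wr; rewrite /r lerDl.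
have w0 : 0 < modulus w by lra.
have fw0 : f w != 0.
  by rewrite -modulus_gt0 (lt_le_trans _ fwn)// exprn_gt0.
(* The correction has degree below [n], so it lies in [M] by the induction hypothesis. *)
pose P : {poly R[i]} := \poly_(j < n) - w ^+ (n - j).
have MP : M (horner P).
  apply: (subspace_horner M0 Mlin) => j jP; apply: ih.
  by rewrite (leq_trans jP)// size_poly.
pose g z := w ^+ n.+1 / f w * diffq w f z + P.[z].
have Mg : M g by apply: Mlin => //; exact: (diffq_subspace HF MF M0 Mlin Mcl ML).
exists g => //.
have gE : (fun z => ('X^n).[z] - g z) = monomial_error f w n.
  apply/funext => z; rewrite /g /monomial_error horner_poly hornerXn.
  rewrite big_ord_recr/= subnn expr0 mul1r.
  have -> : \sum_(i < n) - w ^+ (n - i) * z ^+ i = - \sum_(i < n) w ^+ (n - i) * z ^+ i.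
    by rewrite -sumrN; apply: eq_bigr => i _; rewrite mulNr.
  by ring.
rewrite gE; have Ee : entire (monomial_error f w n).
  by apply: (space_entire HF); rewrite -gE; exact: (space_sub HF (space_horner HF _) (MF Mg)).
have bound z : modulus (monomial_error f w n z) <= (error_constant n K / modulus w) *
    (modulus (f z) + modulus (horner 1 z) + modulus (horner 'X^((n + K).+2) z)).
  have -> : modulus (1 : {poly R[i]}).[z] = 1.
    by rewrite hornerE ComplexField.Normc.normc1.
  rewrite hornerXn modulusX.
  have [zw|/ltW zw] := leP (modulus (z - w)) (modulus w ^- K).
    exact: monomial_error_near.
  exact: monomial_error_far.
have cw : 0 <= error_constant n K / modulus w by rewrite divr_ge0// ltW.
have [_ NE] := space_dom3 HF Ee (MF Mf) (space_horner HF 1)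
  (space_horner HF 'X^((n + K).+2)) cw bound.
apply: le_lt_trans NE _; rewrite -/T.
rewrite mulrA mulrAC ltr_pdivrMr// -ltr_pdivrMl//.
by rewrite mulrC (lt_le_trans _ wr)// /r ltrDr.
Qed.

Lemma invariant_subspace_dichotomy : (forall f, F f -> finite_order f) ->
  M <> [set (fun=> 0)] -> M = F \/ exists n, M = @polynomials_le R n.
Proof.
move=> fo Mnz.
have [Mpoly|nMpoly] := pselect (forall f, M f -> exists q, f = horner q).
  exact: (subspace_polys HF MF M0 Mlin Mcl ML).
left; apply: (subspace_all HF MF M0 Mlin Mcl) => n.
have [f Mf fq] : exists2 f, M f & ~ exists q, f = horner q.
  apply: contrapT => nf; apply: nMpoly => f Mf; apply: contrapT => fq.
  by apply: nf; exists f.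
apply: (subspace_monomials Mf (fo _ (MF Mf))) => q fE.
by apply: fq; exists q.
Qed.

End monomials.

(** * Application to Fock-type spaces *)

Section fock_is_entire_space.
Context {R : realType} (p : R) (W : Cplx R -> R).
Context (hp : 1 <= p) (hW : weight W).
Context (hpoly : fock_dense p W (@polynomials R)).

Lemma fock_entire_space : entire_space (fock p W) (fnorm p W).
Proof.
split.
- exact: fnorm_ge0.
- exact: fock_entire.
- exact: (fock_dom hp hW).
- exact: (fock_horner hpoly).
- exact: (fock_dense_poly hp hW hpoly).
- exact: (fock_lower_bound hp hW).
- move=> r; have [C C0 CP] := poly_point_evaluation hp hW r.
  exists C => // q v vr; apply: CP vr; exact: (fock_horner hpoly).
Qed.

Lemma invariant_subspace_classification (M : set (Cplx R -> Cplx R)) :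
  (forall f, fock p W f -> finite_order f) ->
  invariant_subspace p W (@backward_shift R) M -> M <> [set (fun=> 0)] ->
  M = fock p W \/ exists n, M = @polynomials_le R n.
Proof.
move=> fo [[MF M0 Mlin Mcl] ML].
apply: (invariant_subspace_dichotomy fock_entire_space) => //.
- move=> f ff fe; apply: Mcl => // e e0; have [g Mg ge] := fe e e0.
  exists g => //; have fs := fock_sub hp hW ff (MF _ Mg).
  have -> : (f \- g)%R = (fun z => f z - g z) by [].
  by rewrite (fock_normE hW fs) lte_fin.
- by move=> f Mf; rewrite diffq0; exact: ML.
Qed.

End fock_is_entire_space.

Theorem theorem1p1 (R : realType) (p : R) (W : Cplx R -> R)
    (hp : 1 <= p)
    (hW : weight W)
    (hfin : forall F, fock p W F -> finite_order F)
    (hpoly : fock_dense p W (@polynomials R)) :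
  (forall M : set (Cplx R -> Cplx R),
     invariant_subspace p W (@backward_shift R) M ->
     nontrivial_subspace p W M ->
     exists n : nat, M = @polynomials_le R n)
  /\ unicellular p W (@backward_shift R).
Proof.
have classify M := @invariant_subspace_classification R p W hp hW hpoly M hfin.
split=> [M Minv [Mnz MnF]|M N Minv Ninv].
  by have [|] := classify M Minv Mnz.
have [M0|Mnz] := pselect (M = [set (fun=> 0)]).
  by left; rewrite M0 => _ ->; case: Ninv => -[].
have [N0|Nnz] := pselect (N = [set (fun=> 0)]).
  by right; rewrite N0 => _ ->; case: Minv => -[].
have [MF|[m ME]] := classify M Minv Mnz.
  by right; rewrite MF; case: Ninv => -[].
have [NF|[n NE]] := classify N Ninv Nnz.
  by left; rewrite NF; case: Minv => -[].
have le_sub i j : (i <= j)%N -> @polynomials_le R i `<=` @polynomials_le R j.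
  by move=> ij f [q qi ->]; exists q => //; rewrite (leq_trans qi).
by rewrite ME NE; have [mn|/ltnW nm] := leqP m n; [left|right]; exact: le_sub.
Qed.
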